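(* Let $\phi:\mathbb{P}^1(\overline{\mathbb{Q}}_p)\to\mathbb{P}^1(\overline{\mathbb{Q}}_p)$ be a rational function of good reduction and degree $d>1$. Assume that the point $\infty=(0,1)$ at infinity is fixed under $\phi$. Fix a point $x\in\overline{\mathbb{Q}}_p$ and a sequence $(y_n)_{n\ge1}$ of points $y_n\in\overline{\mathbb{Q}}_p$ such that $y_n$ has least period $n$ under $\phi$. Then $$\frac{|x-y_n|}{\max(1,|x|)\max(1,|y_n|)}\to 1\quad\text{as } n\to\infty.$$ Moreover, $$\log|x-y_n|\to\lambda_{\phi,p}(x)=\log^+|x|\quad\text{as } n\to\infty,$$ and, if $x$ is not a periodic point of $\phi$, then $$\frac{1}{d^n}\log|f_n(x)-x\,g_n(x)|\to\lambda_{\phi,p}(x)=\log^+|x|\quad\text{as } n\to\infty,$$ where $\phi^n=f_n/g_n$ (so $f_n(t)-t\,g_n(t)$ is the polynomial whose roots are exactly the points of $\overline{\mathbb{Q}}_p$ of period $n$, i.e. those fixed by $\phi^n$).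
   Context: $p$ is a prime, $\overline{\mathbb{Q}}_p$ is the algebraic closure of $\mathbb{Q}_p$, $|\cdot|$ is the $p$-adic absolute value with $|p|=1/p$, $O_p=\{z\in\overline{\mathbb{Q}}_p:|z|\le1\}$, $\mathfrak{p}=\{z\in\overline{\mathbb{Q}}_p:|z|<1\}$, and $\log^+ t=\log\max(1,t)$. A point $t\in\overline{\mathbb{Q}}_p$ is identified with the point of $\mathbb{P}^1(\overline{\mathbb{Q}}_p)$ with homogeneous coordinates $(1,t)$, and the remaining point $(0,1)$ is the point at infinity. A rational function $\phi$ has good reduction if it can be written in homogeneous coordinates as $\phi(X,Y)=(F(X,Y),G(X,Y))$ with forms $F,G\in O_p[X,Y]$ of the same degree such that $F$ and $G$ have no common root modulo $\mathfrak{p}$ (i.e. their reductions have no common zero in $\mathbb{P}^1(\overline{\mathbb{F}}_p)$); this degree is the degree $d$ of $\phi$. Fix such $F,G$ and let $(F_n,G_n)$ be the $n$-th iterate of the polynomial map $(F,G)$, a pair of forms of degree $d^n$ representing the $n$-th iterate $\phi^n$. In the representation $\phi^n=f_n/g_n$ one takes $f_n(t)=G_n(1,t)$ and $g_n(t)=F_n(1,t)$; put $g=g_1$. A point $y$ is periodic if $\phi^n(y)=y$ for some $n\ge1$, and has least period $n$ if moreover its orbit $\{y,\phi(y),\phi^2(y),\dots\}$ has cardinality $n$. $\lambda_{\phi,p}$ is the local morphic height (canonical local height of Call and Silverman) of $\phi$ with respect to the fixed point $\infty$, normalized by the representation above: it is the unique function $\lambda_{\phi,p}:\overline{\mathbb{Q}}_p\to\mathbb{R}$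 such that $t\mapsto\lambda_{\phi,p}(t)-\log^+|t|$ is bounded and continuous on $\overline{\mathbb{Q}}_p$ and $\lambda_{\phi,p}(\phi(t))=d\,\lambda_{\phi,p}(t)-\log|g(t)|$ for all $t\in\overline{\mathbb{Q}}_p$ with $g(t)\neq0$. *)

(* Defs.v *)
From HB Require Import structures.
From mathcomp Require Import all_boot all_order all_algebra.
From mathcomp Require Import all_classical all_reals all_analysis.
From mathcomp Require mpoly.
Import -(notations) mpoly.

Set Implicit Arguments.
Unset Strict Implicit.
Unset Printing Implicit Defensive.

Import Order.TTheory GRing.Theory Num.Theory.
Import numFieldNormedType.Exports.

Local Open Scope classical_set_scope.
Local Open Scope ring_scope.

(* The notations of mpoly clash with those of mathcomp-analysis, so they are
   not imported: [mpoly 2 K] is K[X, Y] with X, Y the variables of index 0, 1. *)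

Section AbsoluteValues.
Variables (R : realType) (p : nat).

Definition rat_padic_abs (q : rat) : R :=
  if q == 0 then 0
  else p%:R ^ ((logn p `|denq q|%N)%:Z - (logn p `|numq q|%N)%:Z).

Record nonarchimedean_abs (K : fieldType) (v : K -> R) : Prop :=
  NonarchimedeanAbs {
    nabs_ge0 : forall a, 0 <= v a ;
    nabs_eq0 : forall a, v a = 0 <-> a = 0 ;
    nabsM : forall a b, v (a * b) = v a * v b ;
    nabsD : forall a b, v (a + b) <= Num.max (v a) (v b) }.

Definition abs_complete (K : fieldType) (v : K -> R) : Prop :=
  forall u : nat -> K,
    (forall e : R, 0 < e -> exists N : nat, forall m n : nat,
       (N <= m)%N -> (N <= n)%N -> v (u m - u n) < e) ->
    exists l : K, forall e : R, 0 < e -> exists N : nat, forall n : nat,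
      (N <= n)%N -> v (u n - l) < e.

(* (K, v) is the completion of the rationals for the p-adic absolute value. *)
Record is_Qp (K : fieldType) (v : K -> R) : Prop := IsQp {
  Qp_abs : nonarchimedean_abs v ;
  Qp_rat : forall q : rat, v (ratr q) = rat_padic_abs q ;
  Qp_dense : forall (a : K) (e : R), 0 < e -> exists q : rat, v (a - ratr q) < e ;
  Qp_complete : abs_complete v }.

(* The p-adic numbers and their algebraic closure are not constructed but given
   by their defining properties: for p prime, a term of this type is
   an algebraic closure of the completion of the rationals, with the absolute
   value extended to it. Such a term is unique up to isometric isomorphism. *)
Record Qp_closure := QpClosure {
  Qp_base : fieldType ;
  Qp_base_abs : Qp_base -> R ;
  Qp_baseP : is_Qp Qp_base_abs ;
  Qp_bar :> closedFieldType ;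
  Qp_emb : {rmorphism Qp_base -> Qp_bar} ;
  Qp_bar_algebraic : forall z : Qp_bar, algebraicOver Qp_emb z ;
  pabs : Qp_bar -> R ;
  pabs_nonarchimedean : nonarchimedean_abs pabs ;
  pabs_emb : forall a : Qp_base, pabs (Qp_emb a) = Qp_base_abs a }.

End AbsoluteValues.

Section ProjectiveLine.
Variable K : fieldType.

(* [Some t] is the point with homogeneous coordinates (1, t), and [None] the
   point at infinity (0, 1). *)
Definition P1 : Type := option K.

(* The point with homogeneous coordinates (X, Y); junk if X = Y = 0. *)
Definition P1_of (X Y : K) : P1 := if X == 0 then None else Some (Y / X).

Definition eval2 (H : mpoly 2 K) (X Y : K) : K :=
  meval (tnth [tuple X; Y]) H.

Definition represents (F G : mpoly 2 K) (phi : P1 -> P1) : Prop :=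
  forall X Y : K, ~ (X = 0 /\ Y = 0) ->
    phi (P1_of X Y) = P1_of (eval2 F X Y) (eval2 G X Y).

Fixpoint iter_forms (F G : mpoly 2 K) (n : nat) : mpoly 2 K * mpoly 2 K :=
  if n is m.+1 then
    let FG := [tuple (iter_forms F G m).1; (iter_forms F G m).2] in
    (comp_mpoly FG F, comp_mpoly FG G)
  else (mpolyX K (mnm1 (0 : 'I_2)), mpolyX K (mnm1 (1 : 'I_2))).

(* The polynomial H(1, t) in the variable t. *)
Definition dehomog (H : mpoly 2 K) : {poly K} :=
  mmap polyC (tnth [tuple 1; 'X]) H.

(* The affine coordinate of (X, Y) is Y / X, so the numerator comes from the
   second form. *)
Definition numer (F G : mpoly 2 K) (n : nat) : {poly K} :=
  dehomog (iter_forms F G n).2.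
Definition denom (F G : mpoly 2 K) (n : nat) : {poly K} :=
  dehomog (iter_forms F G n).1.

End ProjectiveLine.

Section Dynamics.
Variables (T : Type) (phi : T -> T).

Definition periodic_point (y : T) : Prop := exists2 n : nat, (0 < n)%N & iter n phi y = y.

Definition forward_orbit (y : T) : set T := range (fun k : nat => iter k phi y).

Definition least_period (n : nat) (y : T) : Prop :=
  periodic_point y /\ (forward_orbit y #= `I_n)%card.

End Dynamics.

Section LocalHeight.
Variables (R : realType) (p : nat) (K : Qp_closure R p).

Definition log_plus (t : R) : R := ln (Num.max 1 t).

(* F and G have no common zero modulo the maximal ideal. The residue field of the valuation ring is an algebraic closure of F_p, and
   every point of its projective line lifts to a pair of integers (X, Y), not
   both in the maximal ideal. *)
Definition no_common_root_mod (F G : mpoly 2 K) : Prop :=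
  forall X Y : K, pabs X <= 1 -> pabs Y <= 1 ->
    ~ (pabs X < 1 /\ pabs Y < 1) ->
    ~ (pabs (eval2 F X Y) < 1 /\ pabs (eval2 G X Y) < 1).

Record good_reduction_form (d : nat) (F G : mpoly 2 K) (phi : P1 K -> P1 K) :
    Prop := GoodReductionForm {
  grf_homogF : F \is ishomog1 d mdeg ;
  grf_homogG : G \is ishomog1 d mdeg ;
  grf_integralF : forall m, pabs (mcoeff m F) <= 1 ;
  grf_integralG : forall m, pabs (mcoeff m G) <= 1 ;
  grf_no_common_root : no_common_root_mod F G ;
  grf_represents : represents F G phi }.

Definition abs_continuous (h : K -> R) : Prop :=
  forall (t : K) (e : R), 0 < e -> exists2 r : R, 0 < r &
    forall s : K, pabs (s - t) < r -> `|h s - h t| < e.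

Definition is_local_height (d : nat) (F G : mpoly 2 K) (phi : P1 K -> P1 K)
    (lam : K -> R) : Prop :=
  [/\ exists M : R, forall t : K, `|lam t - log_plus (pabs t)| <= M,
      abs_continuous (fun t => lam t - log_plus (pabs t)) &
      forall t u : K, (denom F G 1).[t] != 0 -> phi (Some t) = Some u ->
        lam u = d%:R * lam t - ln (pabs (denom F G 1).[t])].

(* A definite description: the unique function with the above property. The
   default value 0 would be taken only if there were none. *)
Definition local_height (d : nat) (F G : mpoly 2 K) (phi : P1 K -> P1 K) :
    K -> R :=
  xget (fun=> 0) [set lam | is_local_height d F G phi lam].

End LocalHeight.

(* Main.v *)
Require Import Defs.
From HB Require Import structures.
From mathcomp Require Import all_boot all_order all_algebra.
From mathcomp Require Import all_classical all_reals all_analysis.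
From mathcomp Require Import ring lra zify.
From mathcomp Require mpoly.
Import Order.TTheory GRing.Theory Num.Theory.
Import numFieldNormedType.Exports.
Local Open Scope classical_set_scope.
Local Open Scope ring_scope.

Set Implicit Arguments.
Unset Strict Implicit.
Unset Printing Implicit Defensive.

(** Good reduction means that the pair of forms [(F, G)] turns the maximum norm of
a vector into its [d]-th power ([good_norm]). Three things follow.

Height. Preservation of the norm says that [log_plus] satisfies the functional
equation of the local height. The difference of two solutions is bounded and
multiplied by [d] under [phi], hence zero ([local_height_unique]).

Periodic points. In a standard affine chart, an iterate of [phi] that maps a
residue disc to itself is there a quotient of integral polynomials with unit
denominator ([chart_iter]). Only one consequence of this is used: its divided
difference [q a b] is integral and Lipschitz with constant [1] ([tame]). Fix
[rho < 1] and a disc of radius [rho]. If two of the [y n] lie in it, some iterate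
[f] of [phi] fixes both, so that [q] takes the value [1] and differs from [1] by at
most [rho] on the whole disc. As in the proof that [(1 + e) ^ (p ^ k)] tends to
[1], the maps [f ^ (p ^ k)] tend to the identity together with their divided
differences ([tame_iter_contract]). Once [h = f ^ (p ^ k)] satisfies
[|h a - h b - (a - b)| <= e |a - b|] with [e < |p|], iterating it adds up
displacements, and [|h ^ j z - z| >= |j| |h z - z|] ([near_id_displacement_lb]).
In particular the periodic points of [f] in the disc are fixed by [h], so their
periods under [phi] are bounded and only finitely many [y n] lie in the disc
([periodic_leave_disc]). This is the chordal limit at [x]. The same limit at
infinity says that [max 1 |y n|] tends to [1], and the limit of
[ln |x - y n|] follows.

Periodic polynomial. Up to the power [1 + d ^ n] of [max 1 |x|], the value at [x] of
[numer n - 'X * denom n] is the chordal distance from [x] to its [n]-th iterate.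
If [x] is not periodic, this distance is at least [c / n] for some [c > 0]
([nonperiodic_return_lb]), because close returns are governed by the same
inequality [|h ^ j x - x| >= |j| |h x - x|], or are all equally close
([tame_recurrence_lb]). Its logarithm divided by [d ^ n] therefore tends to [0]. *)

(** * Nonarchimedean absolute values *)

Section Nonarchimedean.
Context {R : realType} {K : fieldType} {v : K -> R}.
Hypothesis hv : nonarchimedean_abs v.
Implicit Types (a b c : K) (r e : R).

Lemma nabs0 : v 0 = 0.
Proof. by apply/(nabs_eq0 hv). Qed.

Lemma nabs_gt0 a : a != 0 -> 0 < v a.
Proof.
move=> a0; rewrite lt_def (nabs_ge0 hv) andbT.
by apply: contra_neq a0 => /(nabs_eq0 hv).
Qed.

Lemma nabs_neq0 a : 0 < v a -> a != 0.
Proof. by apply: contraTneq => ->; rewrite nabs0 ltxx. Qed.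

Lemma nabs1 : v 1 = 1.
Proof.
have v1 : v 1 != 0 by rewrite gt_eqF// nabs_gt0// oner_eq0.
by apply: (mulfI v1); rewrite -(nabsM hv) !mulr1.
Qed.

Lemma nabsN a : v (- a) = v a.
Proof.
have vN1 : v (-1) = 1.
  apply/eqP; rewrite -(@eqrXn2 _ 2)// ?(nabs_ge0 hv)//.
  by rewrite expr1n expr2 -(nabsM hv) mulrNN mulr1 nabs1.
by rewrite -mulN1r (nabsM hv) vN1 mul1r.
Qed.

Lemma nabsBC a b : v (a - b) = v (b - a).
Proof. by rewrite -nabsN opprB. Qed.

Lemma nabsX a n : v (a ^+ n) = v a ^+ n.
Proof.
elim: n => [|n IH]; first by rewrite !expr0 nabs1.
by rewrite !exprS (nabsM hv) IH.
Qed.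

Lemma nabsV a : v a^-1 = (v a)^-1.
Proof.
have [->|a0] := eqVneq a 0; first by rewrite invr0 nabs0 invr0.
have va0 : v a != 0 by rewrite gt_eqF// nabs_gt0.
by apply: (mulfI va0); rewrite -(nabsM hv) divff// divff// nabs1.
Qed.

Lemma nabs_leD r a b : v a <= r -> v b <= r -> v (a + b) <= r.
Proof. by move=> ar br; apply: le_trans (nabsD hv a b) _; rewrite ge_max ar. Qed.

Lemma nabs_leB r a b : v a <= r -> v b <= r -> v (a - b) <= r.
Proof. by move=> ar br; apply: nabs_leD => //; rewrite nabsN. Qed.

Lemma nabs_leM1 r a b : v a <= r -> v b <= 1 -> v (a * b) <= r.
Proof.
by move=> ar b1; rewrite (nabsM hv) -[r]mulr1 ler_pM// (nabs_ge0 hv).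
Qed.

Lemma nabs_le1M r a b : v a <= 1 -> v b <= r -> v (a * b) <= r.
Proof. by rewrite mulrC => a1 br; exact: nabs_leM1. Qed.

Lemma nabs_dist_trans r b a c : v (a - b) <= r -> v (b - c) <= r ->
  v (a - c) <= r.
Proof. by move=> ab bc; rewrite -(subrKA b); exact: nabs_leD. Qed.

(** In an ultrametric triangle the two longest sides have equal length. *)
Lemma nabs_close a b : v (a - b) < v b -> v a = v b.
Proof.
move=> ab; apply/eqP; rewrite eq_le; apply/andP; split.
  by rewrite -(subrK b a); apply: nabs_leD => //; exact: ltW.
have : v b <= Num.max (v (a - b)) (v a).
  by rewrite -{1}(subrK a b) (nabsBC a b) (nabsD hv).
by rewrite le_max leNgt ab.
Qed.

Lemma nabs_nat n : v n%:R <= 1.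
Proof.
elim: n => [|n IH]; first by rewrite nabs0.
by rewrite mulrSr nabs_leD// nabs1.
Qed.

Lemma nabs_prod_le1 n (h : nat -> K) : (forall i, (i < n)%N -> v (h i) <= 1) ->
  v (\prod_(i < n) h i) <= 1.
Proof.
elim: n => [|n IH] h1; first by rewrite big_ord0 nabs1.
rewrite big_ord_recr /=; apply: nabs_leM1; last exact: h1.
by apply: IH => i i_n; apply: h1; exact: ltnW.
Qed.

End Nonarchimedean.

(** * Functions with integral Lipschitz divided differences *)

Section Tame.
Context {R : realType} {K : fieldType} {v : K -> R}.
Hypothesis hv : nonarchimedean_abs v.
Implicit Types (a b c : K) (h k f : K -> K) (q : K -> K -> K) (B : set K).

(** On the closed unit ball this plays the part of a power series with integral
coefficients: [q a b] is the divided difference [(h a - h b) / (a - b)],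
extended to the diagonal by the derivative. *)
Record tame B h q : Prop := Tame {
  tame_le1 : forall {a}, B a -> v (h a) <= 1 ;
  tame_dd : forall {a b}, B a -> B b -> h a - h b = q a b * (a - b) ;
  tame_dd_le1 : forall {a b}, B a -> B b -> v (q a b) <= 1 ;
  tame_dd_lip : forall {r a b a' b'}, B a -> B b -> B a' -> B b' ->
    v (a - a') <= r -> v (b - b') <= r -> v (q a b - q a' b') <= r }.

Definition is_tame B h := exists q, tame B h q.

Lemma tame_lip B h q a b : tame B h q -> B a -> B b ->
  v (h a - h b) <= v (a - b).
Proof.
move=> [_ hq q1 _] Ba Bb; rewrite hq//.
by apply: nabs_le1M => //; exact: q1.
Qed.

Lemma is_tame_cst B c : v c <= 1 -> is_tame B (fun=> c).
Proof.
move=> c1; exists (fun _ _ => 0); split=> //.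
- by move=> a b _ _; rewrite subrr mul0r.
- by move=> a b _ _; rewrite nabs0.
- move=> r a b a' b' _ _ _ _ ar _; rewrite subrr nabs0//.
  exact: le_trans (nabs_ge0 hv _) ar.
Qed.

Lemma is_tame_id B : (forall a, B a -> v a <= 1) -> is_tame B id.
Proof.
move=> B1; exists (fun _ _ => 1); split=> //.
- by move=> a b _ _; rewrite mul1r.
- by move=> a b _ _; rewrite nabs1.
- move=> r a b a' b' _ _ _ _ ar _; rewrite subrr nabs0//.
  exact: le_trans (nabs_ge0 hv _) ar.
Qed.

Lemma is_tameD B h k : is_tame B h -> is_tame B k ->
  is_tame B (fun a => h a + k a).
Proof.
move=> [q [h1 hq q1 ql]] [s [k1 ks s1 sl]].
exists (fun a b => q a b + s a b); split.
- by move=> a Ba; apply: nabs_leD => //; [exact: h1|exact: k1].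
- by move=> a b Ba Bb; rewrite mulrDl -hq// -ks//; ring.
- by move=> a b Ba Bb; apply: nabs_leD => //; [exact: q1|exact: s1].
- move=> r a b a' b' Ba Bb Ba' Bb' ar br; rewrite opprD addrACA.
  by apply: nabs_leD => //; [exact: ql|exact: sl].
Qed.

(** Leibniz rule: [(hk)[a, b] = h[a, b] k(a) + h(b) k[a, b]]. *)
Lemma is_tameM B h k : is_tame B h -> is_tame B k ->
  is_tame B (fun a => h a * k a).
Proof.
move=> [q hh] [s kk].
have [h1 hq q1 ql] := hh; have [k1 ks s1 sl] := kk.
exists (fun a b => q a b * k a + h b * s a b); split.
- by move=> a Ba; apply: nabs_leM1 => //; [exact: h1|exact: k1].
- move=> a b Ba Bb; rewrite mulrDl mulrAC -hq// -mulrA -ks//; ring.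
- move=> a b Ba Bb; apply: nabs_leD => //.
    by apply: nabs_leM1 => //; [exact: q1|exact: k1].
  by apply: nabs_leM1 => //; [exact: h1|exact: s1].
- move=> r a b a' b' Ba Bb Ba' Bb' ar br.
  have -> : q a b * k a + h b * s a b - (q a' b' * k a' + h b' * s a' b') =
    ((q a b - q a' b') * k a + q a' b' * (k a - k a')) +
    ((h b - h b') * s a b + h b' * (s a b - s a' b')) by ring.
  apply: nabs_leD => //; apply: nabs_leD => //.
  + by apply: nabs_leM1 => //; [exact: ql|exact: k1].
  + apply: nabs_le1M => //; first exact: q1.
    exact: le_trans (tame_lip kk _ _) ar.
  + apply: nabs_leM1 => //; last exact: s1.
    exact: le_trans (tame_lip hh _ _) br.
  + by apply: nabs_le1M => //; [exact: h1|exact: sl].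
Qed.

Lemma is_tameX B h n : is_tame B h -> is_tame B (fun a => h a ^+ n).
Proof.
move=> th; elim: n => [|n IH].
  by under eq_fun do rewrite expr0; apply: is_tame_cst; rewrite nabs1.
by under eq_fun do rewrite exprS; exact: is_tameM.
Qed.

Lemma is_tameV B h : is_tame B h -> (forall a, B a -> v (h a) = 1) ->
  is_tame B (fun a => (h a)^-1).
Proof.
move=> [q hh] hu; have [h1 hq q1 ql] := hh.
have h0 a : B a -> h a != 0 by move=> Ba; apply: (nabs_neq0 hv); rewrite hu.
have hV1 a : B a -> v (h a)^-1 <= 1 by move=> Ba; rewrite nabsV// hu// invr1.
have hVl a b : B a -> B b -> v ((h a)^-1 - (h b)^-1) <= v (a - b).
  move=> Ba Bb.
  have -> : (h a)^-1 - (h b)^-1 = (h b - h a) * ((h a)^-1 * (h b)^-1).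
    by field; rewrite !h0.
  apply: nabs_leM1 => //; first by rewrite (nabsBC hv a) (tame_lip hh).
  by apply: nabs_leM1 => //; exact: hV1.
exists (fun a b => - q a b * ((h a)^-1 * (h b)^-1)); split=> //.
- move=> a b Ba Bb; rewrite mulrAC mulNr -hq//; field; rewrite !h0//.
- move=> a b Ba Bb; apply: nabs_leM1 => //; first by rewrite nabsN// q1.
  by apply: nabs_leM1 => //; exact: hV1.
- move=> r a b a' b' Ba Bb Ba' Bb' ar br.
  set w := (h a)^-1; set w' := (h a')^-1; set z := (h b)^-1; set z' := (h b')^-1.
  have -> : - q a b * (w * z) - - q a' b' * (w' * z') =
    (q a' b' - q a b) * (w * z) +
    q a' b' * ((w' - w) * z + w' * (z' - z)) by ring.
  apply: nabs_leD => //.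
    apply: nabs_leM1 => //; first by rewrite nabsBC// ql.
    by apply: nabs_leM1 => //; exact: hV1.
  apply: nabs_le1M => //; first exact: q1.
  apply: nabs_leD => //.
    apply: nabs_leM1 => //; last exact: hV1.
    by rewrite nabsBC//; exact: le_trans (hVl _ _ Ba Ba') ar.
  apply: nabs_le1M => //; first exact: hV1.
  by rewrite nabsBC//; exact: le_trans (hVl _ _ Bb Bb') br.
Qed.

(** Chain rule for divided differences: [(f^n)[a, b]] is a product over the
orbits of [a] and [b]. *)
Lemma tame_iter B f q n : (forall a, B a -> B (f a)) ->
  (forall a, B a -> v a <= 1) -> tame B f q ->
  tame B (iter n f) (fun a b => \prod_(i < n) q (iter i f a) (iter i f b)).
Proof.
move=> fB B1 tf; have [f1 fq q1 ql] := tf.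
have iB i a : B a -> B (iter i f a) by elim: i => //= i IH /IH /fB.
have il i a b : B a -> B b -> v (iter i f a - iter i f b) <= v (a - b).
  move=> Ba Bb; elim: i => //= i; apply: le_trans.
  by apply: (tame_lip tf); exact: iB.
elim: n => [|n [h1 hq p1 pl]]; split=> //=.
- by move=> a b _ _; rewrite big_ord0 mul1r.
- by move=> a b _ _; rewrite big_ord0 nabs1.
- move=> r a b a' b' _ _ _ _ ar _; rewrite !big_ord0 subrr nabs0//.
  exact: le_trans (nabs_ge0 hv _) ar.
- by move=> a Ba; apply: f1; exact: iB.
- move=> a b Ba Bb; rewrite fq; try exact: iB.
  by rewrite hq// big_ord_recr /= mulrA [in RHS](mulrC _ (q _ _)).
- move=> a b Ba Bb; apply: (nabs_prod_le1 hv
    (h := fun i => q (iter i f a) (iter i f b))) => i _.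
  by apply: q1; exact: iB.
- move=> r a b a' b' Ba Bb Ba' Bb' ar br; rewrite !big_ord_recr /=.
  set P := \prod_(i < n) q (iter i f a) _; set P' := \prod_(i < n) q (iter i f a') _.
  set s := q _ _; set s' := q _ _.
  have -> : P * s - P' * s' = (P - P') * s + P' * (s - s') by ring.
  apply: nabs_leD => //.
    by apply: nabs_leM1 => //; [exact: pl|apply: q1; exact: iB].
  apply: nabs_le1M => //; first exact: p1.
  by apply: ql; do ?[exact: iB|exact: le_trans (il _ _ _ _ _) _].
Qed.

End Tame.

Arguments tame {R K} v B h q.
Arguments is_tame {R K} v B h.

(** * Iterates of a map close to the identity *)

Section NearIdentity.
Context {R : realType} {K : fieldType} {v : K -> R}.
Hypothesis hv : nonarchimedean_abs v.
Implicit Types (a b c z : K) (f h : K -> K) (q : K -> K -> K) (B : set K).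

Definition near_id B (e : R) h :=
  (forall a, B a -> B (h a)) /\
  (forall a b, B a -> B b -> v (h a - h b - (a - b)) <= e * v (a - b)).

Lemma near_id_lip B e h a b : e <= 1 -> near_id B e h -> B a -> B b ->
  v (h a - h b) <= v (a - b).
Proof.
move=> e1 [_ hh] Ba Bb; rewrite -(subrK (a - b) (h a - h b)).
apply: nabs_leD => //; apply: le_trans (hh _ _ Ba Bb) _.
by rewrite ler_piMl ?(nabs_ge0 hv).
Qed.

Lemma near_id_iter B e h n : e <= 1 -> 0 <= e ->
  near_id B e h -> near_id B e (iter n h).
Proof.
move=> e1 e0 nh; elim: n => [|n [IB Il]]; split=> //=.
- by move=> a b _ _; rewrite subrr nabs0// mulr_ge0// (nabs_ge0 hv).
- by move=> a Ba; apply: (proj1 nh); exact: IB.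
- move=> a b Ba Bb; set a' := iter n h a; set b' := iter n h b.
  have l' : v (a' - b') <= v (a - b).
    rewrite -(subrK (a - b) (a' - b')); apply: nabs_leD => //.
    by apply: le_trans (Il _ _ Ba Bb) _; rewrite ler_piMl ?(nabs_ge0 hv).
  apply: (nabs_dist_trans hv (b := a' - b') _ (Il _ _ Ba Bb)).
  apply: le_trans (proj2 nh _ _ (IB _ Ba) (IB _ Bb)) _.
  by rewrite ler_wpM2l.
Qed.

(** To first order, iterating adds up equal displacements. *)
Lemma near_id_displacement B e h n z : e <= 1 -> 0 <= e -> near_id B e h -> B z ->
  v (iter n h z - z - n%:R * (h z - z)) <= e * v (h z - z).
Proof.
move=> e1 e0 nh Bz; set g := h z - z.
have hB i : B (iter i h z) by elim: i => //= i /(proj1 nh).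
have ig i : v (iter i h z - z) <= v g.
  elim: i => [|i IH] /=; first by rewrite subrr nabs0// (nabs_ge0 hv).
  apply: (nabs_dist_trans hv (b := h z)); last exact: lexx.
  exact: le_trans (near_id_lip e1 nh (hB _) Bz) IH.
elim: n => [|n IH] /=.
  by rewrite subrr mul0r subrr nabs0// mulr_ge0// (nabs_ge0 hv).
set w := iter n h z in IH *.
have -> : h w - z - n.+1%:R * g = (w - z - n%:R * g) + (h w - h z - (w - z)).
  by rewrite /g mulrSr; ring.
apply: nabs_leD => //; apply: le_trans (proj2 nh _ _ (hB n) Bz) _.
by rewrite ler_wpM2l// ig.
Qed.

(** By the previous lemma iterating a prime number [l] of times multiplies the
displacement by [|l|] exactly, as soon as [e < |l|]; general iterates are
reached one prime factor at a time. *)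
Lemma near_id_displacement_lb B e h n z : e <= 1 -> 0 <= e ->
  (forall l, prime l -> e < v l%:R) -> near_id B e h -> B z -> (0 < n)%N ->
  v n%:R * v (h z - z) <= v (iter n h z - z).
Proof.
move=> e1 e0 el; elim/ltn_ind: n h => n IH h nh Bz n0.
have [n1|n_gt1] := leqP n 1.
  have -> : n = 1%N by apply/eqP; rewrite eqn_leq n1 n0.
  by rewrite nabs1// mul1r.
have pl := pdiv_prime n_gt1; set l := pdiv n in pl.
have [m nE] : exists m, n = (m * l)%N by exists (n %/ l)%N; rewrite divnK ?pdiv_dvd.
have m0 : (0 < m)%N by case: m nE n0 => //; rewrite mul0n => ->.
have mn : (m < n)%N by rewrite nE ltn_Pmulr// prime_gt1.
set k := iter l h.
have nk : near_id B e k by exact: near_id_iter.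
have -> : iter n h z = iter m k z by rewrite nE /k iterM.
apply: le_trans (IH m mn k nk Bz m0).
rewrite nE natrM (nabsM hv) -mulrA ler_wpM2l ?(nabs_ge0 hv)//.
have [hz|hz] := eqVneq (h z - z) 0.
  by rewrite hz nabs0// mulr0 (nabs_ge0 hv).
have vg := nabs_gt0 hv hz.
rewrite -(nabsM hv) [leRHS](nabs_close hv (b := l%:R * (h z - z)))//.
apply: le_lt_trans (near_id_displacement l e1 e0 nh Bz) _.
by rewrite (nabsM hv) ltr_pM2r// el.
Qed.

(** The argument by which [(1 + e) ^ p] is closer to [1] than [1 + e]: writing
[q = 1 + e], the divided difference of [f ^ p] is [1 + p * e] up to terms which
are smaller by a factor [t], where [t] bounds both [|p|] and [|e|], and likewise
for the displacement. Each of the two estimates needs the other, hence the joint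
conclusion, in a form that can be iterated. *)
Lemma tame_iter_contract B f q (p : nat) (t d : R) :
  v p%:R <= t -> t <= 1 -> d <= t ->
  (forall a, B a -> B (f a)) -> (forall a, B a -> v a <= 1) -> tame v B f q ->
  (forall a b, B a -> B b -> v (q a b - 1) <= d) ->
  (forall a, B a -> v (f a - a) <= t * d) ->
  exists q', [/\ tame v B (iter p f) q',
    forall a b, B a -> B b -> v (q' a b - 1) <= t * d &
    forall a, B a -> v (iter p f a - a) <= t * (t * d)].
Proof.
move=> pt t1 dt fB B1 tf qd fd.
exists (fun a b => \prod_(i < p) q (iter i f a) (iter i f b)).
have iB i a : B a -> B (iter i f a) by elim: i => //= i IH /IH /fB.
have t0 : 0 <= t := le_trans (nabs_ge0 hv _) pt.
have d0' a : B a -> 0 <= d.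
  by move=> Ba; apply: le_trans (qd a a Ba Ba); exact: nabs_ge0.
have d1 : d <= 1 := le_trans dt t1.
have nf : near_id B d f.
  split=> // a b Ba Bb.
  rewrite (tame_dd tf)// -{2}[a - b]mul1r -mulrBl (nabsM hv).
  by rewrite ler_wpM2r ?(nabs_ge0 hv)// qd.
have ifd i a : B a -> v (iter i f a - a) <= t * d.
  move=> Ba; elim: i => [|i IH] /=.
    by rewrite subrr nabs0// mulr_ge0// (d0' a).
  apply: (nabs_dist_trans hv (b := f a)); last exact: fd.
  exact: le_trans (tame_lip hv tf (iB _ _ Ba) Ba) IH.
split; first exact: tame_iter.
- move=> a b Ba Bb; have d0 := d0' a Ba.
  set e := q a b - 1.
  suff : forall j,
      v (\prod_(i < j) q (iter i f a) (iter i f b) - 1 - j%:R * e) <= t * d.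
    move=> /(_ p) H; rewrite -(subrK (p%:R * e) (_ - 1)).
    apply: nabs_leD => //; rewrite (nabsM hv).
    by rewrite ler_pM ?(nabs_ge0 hv)// qd.
  elim=> [|j IH]; first by rewrite big_ord0 subrr mul0r subrr nabs0// mulr_ge0.
  rewrite big_ord_recr /=; set P := \prod_(i < j) _ in IH *.
  set s := q (iter j f a) (iter j f b).
  have -> : P * s - 1 - j.+1%:R * e =
    (P - 1 - j%:R * e) * s + ((s - q a b) + j%:R * (e * (s - 1))).
    by rewrite /e mulrSr; ring.
  apply: nabs_leD => //.
    by apply: nabs_leM1 => //; apply: (tame_dd_le1 tf); exact: iB.
  apply: nabs_leD => //.
    by apply: (tame_dd_lip tf); do ?[exact: iB|exact: ifd].
  apply: nabs_le1M => //; first exact: nabs_nat.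
  rewrite (nabsM hv) ler_pM ?(nabs_ge0 hv)//.
    exact: le_trans (qd _ _ Ba Bb) dt.
  by apply: qd; exact: iB.
- move=> a Ba; have d0 := d0' a Ba.
  rewrite -(subrK (p%:R * (f a - a)) (_ - a)); apply: nabs_leD => //.
    apply: le_trans (near_id_displacement p d1 d0 nf Ba) _.
    by rewrite ler_pM ?(nabs_ge0 hv)// fd.
  by rewrite (nabsM hv) ler_pM ?(nabs_ge0 hv)// fd.
Qed.

(** The iterates [f ^ (p ^ k)] tend to the identity geometrically, so that one of
them falls under the threshold [|p|] of [near_id_displacement_lb]. *)
Lemma tame_return_lb B f q (p : nat) (rho : R) : (0 < p)%N ->
  0 < v p%:R -> v p%:R < 1 -> (forall l, prime l -> v p%:R <= v l%:R) ->
  (forall a, B a -> B (f a)) -> (forall a, B a -> v a <= 1) -> tame v B f q ->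
  0 <= rho -> rho < 1 ->
  (forall a b, B a -> B b -> v (q a b - 1) <= rho) ->
  (forall a, B a -> v (f a - a) <= rho) ->
  exists2 N, (0 < N)%N & forall z j, B z -> (0 < j)%N ->
    v j%:R * v (iter N f z - z) <= v (iter (N * j) f z - z).
Proof.
move=> p0 vp0 vp1 vpl fB B1 tf rho0 rho1 qr fr.
(* The square root makes the displacement bound rho of the form t * t. *)
set t := Num.max (v p%:R) (Num.sqrt rho).
have t0 : 0 < t by rewrite lt_max vp0.
have t1 : t < 1 by rewrite gt_max vp1 -sqrtr1 ltr_sqrt.
have st : Num.sqrt rho <= t by rewrite le_max lexx orbT.
have rt2 : rho <= t * t by rewrite -[leLHS]sqr_sqrtr// expr2 ler_pM ?sqrtr_ge0.
have rt : rho <= t by apply: le_trans rt2 _; rewrite ler_piMl// ltW.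
have key k : exists q', [/\ tame v B (iter (p ^ k) f) q',
    forall a b, B a -> B b -> v (q' a b - 1) <= t ^+ k.+1 &
    forall a, B a -> v (iter (p ^ k) f a - a) <= t * t ^+ k.+1].
  elim: k => [|k [q' [tq' q'1 fq']]].
    exists q; rewrite expn0 expr1; split=> //.
    - by move=> a b Ba Bb; exact: le_trans (qr _ _ Ba Bb) rt.
    - by move=> a Ba; exact: le_trans (fr _ Ba) rt2.
  have iB i a : B a -> B (iter i f a) by elim: i => //= i IH /IH /fB.
  have [||||||||q'' [h1 h2 h3]] :=
    @tame_iter_contract B (iter (p ^ k) f) q' p t (t ^+ k.+1) => //.
  - by rewrite le_max lexx.
  - exact: ltW.
  - by rewrite exprS ler_piMr ?(ltW t0)// exprn_ile1// ltW.
  - by move=> a; exact: iB.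
  exists q''; rewrite expnS exprS.
  have E : iter (p * p ^ k) f = iter p (iter (p ^ k) f).
    by apply/funext => z; rewrite iterM.
  by rewrite E.
have [k tk] : exists k, t ^+ k.+1 < v p%:R.
  have /cvgrPdist_lt /(_ _ vp0) [k _ /(_ k.+1)] :=
    @cvg_expr R t (ltac:(by rewrite ger0_norm ?ltW)).
  rewrite /= sub0r normrN ger0_norm ?exprn_ge0 ?ltW// => /(_ (leqnSn _)).
  by exists k.
have [q' [tq' q'1 _]] := key k.
exists (p ^ k)%N; first by rewrite expn_gt0 p0.
move=> z j Bz j0; rewrite mulnC iterM.
apply: (near_id_displacement_lb (B := B) (e := t ^+ k.+1)) => //.
- by rewrite exprn_ile1// ltW.
- by rewrite exprn_ge0// ltW.
- by move=> l /vpl; exact: lt_le_trans.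
- split; first by elim: (p ^ k)%N => //= i IH a /IH /fB.
  move=> a b Ba Bb.
  rewrite (tame_dd tq')// -{2}[a - b]mul1r -mulrBl (nabsM hv).
  by rewrite ler_wpM2r ?(nabs_ge0 hv)// q'1.
Qed.

End NearIdentity.

Section Recurrence.
Context {R : realType} {K : fieldType} {v : K -> R}.
Hypothesis hv : nonarchimedean_abs v.

(** Returns of a nonperiodic point cannot be too close. Let [lam] be the
derivative at the point. If some power of [lam] is close to [1], an iterate of
the map is close to the identity on the disc and [tame_return_lb] applies.
Otherwise the displacement under [f ^ j] is the first displacement times the
geometric sum [1 + ... + lam ^ (j - 1)], up to terms too small to matter, and
[(lam - 1)] times this sum is [lam ^ j - 1], of absolute value at least [1]. *)
Lemma tame_recurrence_lb (u0 : K) (rho : R) f q (p : nat) : (0 < p)%N ->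
  0 < v p%:R -> v p%:R < 1 -> (forall l, prime l -> v p%:R <= v l%:R) ->
  let B := [set u | v (u - u0) <= rho] in
  0 <= rho -> rho < 1 -> (forall u, B u -> v u <= 1) ->
  (forall u, B u -> B (f u)) -> tame v B f q ->
  (forall j, (0 < j)%N -> iter j f u0 != u0) ->
  exists J c, [/\ (0 < J)%N, 0 < c & forall j, (0 < j)%N ->
    c * v j%:R <= v (iter (J * j) f u0 - u0)].
Proof.
move=> p0 vp0 vp1 vpl B rho0 rho1 B1 fB tf aper.
have Bu0 : B u0 by rewrite /B /= subrr nabs0.
have iB i a : B a -> B (iter i f a) by elim: i => //= i IH /IH /fB.
set lam := q u0 u0.
have lam1 : v lam <= 1 by exact: (tame_dd_le1 tf).
have qlam a b : B a -> B b -> v (q a b - lam) <= rho.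
  by move=> Ba Bb; apply: (tame_dd_lip tf).
have [[i [i0 lami]]|nolam] := pselect (exists i, (0 < i)%N /\ v (lam ^+ i - 1) < 1).
  have th := tame_iter hv i fB B1 tf.
  pose rho' := Num.max (v (lam ^+ i - 1)) rho.
  have Q1 a b : B a -> B b ->
      v (\prod_(l < i) q (iter l f a) (iter l f b) - 1) <= rho'.
    move=> Ba Bb; apply: (nabs_dist_trans hv (b := lam ^+ i)); last first.
      by rewrite /rho' le_max lexx.
    rewrite /rho' le_max; apply/orP; right.
    elim: (i) => [|k IH]; first by rewrite big_ord0 expr0 subrr nabs0.
    rewrite big_ord_recr exprSr /=; set P := \prod_(_ < k) _ in IH *.
    set s := q _ _.
    have -> : P * s - lam ^+ k * lam = (P - lam ^+ k) * s + lam ^+ k * (s - lam).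
      by ring.
    apply: nabs_leD => //.
      by apply: nabs_leM1 => //; apply: (tame_dd_le1 tf); exact: iB.
    apply: nabs_le1M => //; first by rewrite nabsX// exprn_ile1// nabs_ge0.
    by apply: qlam; exact: iB.
  have [|||N N0 HN] := tame_return_lb hv p0 vp0 vp1 vpl (iB i) B1 th
    (rho := rho') _ _ Q1.
  - by rewrite le_max rho0 orbT.
  - by rewrite gt_max lami.
  - move=> a Ba; rewrite /rho' le_max; apply/orP; right.
    apply: (nabs_dist_trans hv (b := u0)); first exact: iB.
    by rewrite nabsBC.
  exists (i * N)%N, (v (iter N (iter i f) u0 - u0)); split.
  - by rewrite muln_gt0 i0.
  - by apply: (nabs_gt0 hv); rewrite subr_eq0 -iterM aper// muln_gt0 N0.
  - move=> j j0; rewrite mulrC -mulnA (mulnC i) iterM; exact: HN.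
set e1 := f u0 - u0.
have e10 : 0 < v e1 by apply: (nabs_gt0 hv); rewrite subr_eq0 (aper 1%N).
exists 1%N, (v e1); split=> // j j0; rewrite mul1n.
apply: (@le_trans _ _ (v e1)); first by rewrite ler_piMr ?(nabs_ge0 hv)// nabs_nat.
pose S j := \sum_(l < j) lam ^+ l.
have S1 : 1 <= v (S j).
  have : 1 <= v (lam ^+ j - 1).
    by rewrite leNgt; apply/negP => lj; apply: nolam; exists j.
  rewrite subrX1 (nabsM hv) => /le_trans -> //.
  by rewrite ler_piMl ?(nabs_ge0 hv)// nabs_leB// nabs1.
have ie1 k : v (iter k f u0 - u0) <= v e1.
  elim: k => [|k IH] /=; first by rewrite subrr nabs0// ltW.
  apply: (nabs_dist_trans hv (b := f u0)); last exact: lexx.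
  exact: le_trans (tame_lip hv tf (iB _ _ Bu0) Bu0) IH.
have eS k : v (iter k f u0 - u0 - S k * e1) <= rho * v e1.
  elim: k => [|k IH].
    by rewrite /S big_ord0 mul0r subr0 subrr nabs0// mulr_ge0// ltW.
  have SS : S k.+1 = lam * S k + 1.
    rewrite /S big_ord_recl expr0 addrC big_distrr /=; congr (_ + _).
    by apply: eq_bigr => l _; rewrite -exprS.
  rewrite /= SS; set w := iter k f u0 in IH *.
  have Bw : B w := iB k _ Bu0.
  have -> : f w - u0 - (lam * S k + 1) * e1 =
      (q w u0 - lam) * (w - u0) + lam * (w - u0 - S k * e1).
    have -> : f w - u0 = (f w - f u0) + e1 by rewrite /e1; ring.
    by rewrite (tame_dd tf Bw Bu0); ring.
  apply: nabs_leD => //; last exact: nabs_le1M.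
  by rewrite (nabsM hv) ler_pM ?(nabs_ge0 hv)// ?qlam// ie1.
have le1S : v e1 <= v (S j * e1) by rewrite (nabsM hv) ler_peMl// ltW.
rewrite [leRHS](nabs_close hv (b := S j * e1))//.
apply: le_lt_trans (eS j) _; apply: lt_le_trans le1S.
by rewrite gtr_pMl.
Qed.

End Recurrence.

(** * The absolute value of an integer *)

Section PadicInteger.
Context {R : realType} {p : nat} {K : Qp_closure R p}.
Hypothesis p_prime : prime p.

Lemma pabs_nat n : (0 < n)%N -> pabs (n%:R : K) = p%:R ^- logn p n.
Proof.
move=> n0; rewrite -(rmorph_nat (Qp_emb K)) pabs_emb.
have -> : (n%:R : Qp_base K) = ratr n%:R by rewrite ratr_nat.
rewrite (Qp_rat (Qp_baseP K)) /rat_padic_abs.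
rewrite pnatr_eq0 gtn_eqF//.
have -> : (n%:R : rat) = (n%:Z)%:~R by [].
by rewrite numq_int denq_int /= logn1 sub0r -exprnN.
Qed.

Lemma pabs_p_lt1 : pabs (p%:R : K) < 1.
Proof.
rewrite pabs_nat ?prime_gt0// logn_prime// eqxx expr1.
by rewrite invf_lt1 ?ltr0n ?ltr1n ?prime_gt0 ?prime_gt1.
Qed.

Lemma pabs_nat_gt0 n : (0 < n)%N -> 0 < pabs (n%:R : K).
Proof.
by move=> n0; rewrite pabs_nat// invr_gt0 exprn_gt0// ltr0n prime_gt0.
Qed.

Lemma pabs_p_le_prime l : prime l -> pabs (p%:R : K) <= pabs (l%:R : K).
Proof.
move=> pl; rewrite [pabs l%:R]pabs_nat ?prime_gt0// logn_prime//.
have [lp|_] := eqVneq p l; last by rewrite expr0 invr1 ltW// pabs_p_lt1.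
by rewrite pabs_nat ?prime_gt0// logn_prime// eqxx.
Qed.

Lemma pabs_nat_lb n : (0 < n)%N -> n%:R^-1 <= pabs (n%:R : K).
Proof.
move=> n0; rewrite pabs_nat// lef_pV2 ?posrE ?exprn_gt0 ?ltr0n ?(prime_gt0 p_prime)//.
by rewrite -natrX ler_nat dvdn_leq// pfactor_dvdnn.
Qed.

End PadicInteger.

(** * Binary forms and points of the projective line *)

Section BinaryForms.
Import -(notations) mpoly.
Variable K : fieldType.
Implicit Types (H F G : mpoly.mpoly 2 K) (X Y : K).

Lemma eval2E H X Y : eval2 H X Y = \sum_(m <- mpoly.msupp H)
  mpoly.mcoeff m H * (X ^+ mpoly.fun_of_multinom m 0 * Y ^+ mpoly.fun_of_multinom m 1).
Proof.
rewrite /eval2 mpoly.mevalE; apply: eq_bigr => m _.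
rewrite !big_ord_recl big_ord0 /= mulr1 !(tnth_nth 0) /=.
by rewrite (_ : lift ord0 ord0 = 1)//; exact/val_inj.
Qed.

Lemma eval2_homog d H c X Y : H \is mpoly.ishomog1 d mpoly.mdeg ->
  eval2 H (c * X) (c * Y) = c ^+ d * eval2 H X Y.
Proof.
move=> /mpoly.dhomogP Hd; rewrite !eval2E big_distrr /=.
apply: eq_big_seq => m /Hd; rewrite /= mpoly.mdegE !big_ord_recl big_ord0 addn0 => <-.
rewrite !exprMn exprD (_ : lift ord0 ord0 = 1); first ring.
exact/val_inj.
Qed.

Lemma horner_dehomog H t : (dehomog H).[t] = eval2 H 1 t.
Proof.
rewrite /dehomog /mpoly.mmap eval2E horner_sum; apply: eq_bigr => m _.
rewrite /mpoly.mmap1 !big_ord_recl big_ord0 mulr1 !(tnth_nth 0) /= !hornerE.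
by rewrite (_ : lift ord0 ord0 = 1)//; exact/val_inj.
Qed.

Lemma eval2_iter_forms0 F G X Y : (eval2 (iter_forms F G 0).1 X Y = X) *
  (eval2 (iter_forms F G 0).2 X Y = Y).
Proof. by rewrite /eval2 /= !mpoly.mevalXU. Qed.

Lemma eval2_iter_formsS F G n X Y :
  let U := eval2 (iter_forms F G n).1 X Y in
  let V := eval2 (iter_forms F G n).2 X Y in
  (eval2 (iter_forms F G n.+1).1 X Y = eval2 F U V) *
  (eval2 (iter_forms F G n.+1).2 X Y = eval2 G U V).
Proof.
split; rewrite /eval2 /= mpoly.comp_mpoly_meval; apply: mpoly.meval_eq => i;
  rewrite !(tnth_nth 0); case: i => -[|[]]//=.
Qed.

Lemma P1_of_inj X Y X' Y' : ~ (X = 0 /\ Y = 0) -> ~ (X' = 0 /\ Y' = 0) ->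
  P1_of X Y = P1_of X' Y' <-> X * Y' = X' * Y.
Proof.
rewrite /P1_of => n0 n0'.
have [X0|X0] := eqVneq X 0; have [X0'|X0'] := eqVneq X' 0.
- by rewrite X0 X0' !mul0r.
- split=> // /esym/eqP; rewrite X0 mul0r mulf_eq0 (negbTE X0') => /eqP Y0.
  by case: n0.
- split=> // /eqP; rewrite X0' mul0r mulf_eq0 (negbTE X0) => /eqP Y0.
  by case: n0'.
- split=> [[] /(congr1 (fun z => X * X' * z)) e|e].
    have -> : X * Y' = X * X' * (Y' / X') by field.
    by rewrite -e; field.
  congr Some; apply: (mulfI (mulf_neq0 X0 X0')).
  have -> : X * X' * (Y / X) = X' * Y by field.
  by rewrite -e; field.
Qed.

(** The two standard charts of the projective line: [u] stands for [(1, u)] in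
one of them and for [(u, 1)] in the other. *)
Definition chartX (s : bool) (u : K) := if s then u else 1.
Definition chartY (s : bool) (u : K) := if s then 1 else u.
Definition chart s u : P1 K := P1_of (chartX s u) (chartY s u).

Lemma chart_neq0 s u : ~ (chartX s u = 0 /\ chartY s u = 0).
Proof. by case: s => -[] /= /eqP; rewrite ?oner_eq0// => _ /eqP; rewrite oner_eq0. Qed.

Lemma chart_inj s : injective (chart s).
Proof.
move=> u u' /(P1_of_inj (@chart_neq0 s u) (@chart_neq0 s u')).
by case: s => /=; rewrite !(mulr1, mul1r).
Qed.

Lemma chart_Some t : Some t = chart false t.
Proof. by rewrite /chart /P1_of /= oner_eq0 divr1. Qed.

Lemma chart_SomeV t : t != 0 -> Some t = chart true t^-1.
Proof. by move=> t0; rewrite /chart /P1_of /= invr_eq0 (negbTE t0) div1r invrK. Qed.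

End BinaryForms.

(** * Good reduction *)

Section GoodReduction.
Context {R : realType} {p : nat} {K : Qp_closure R p}.
Local Notation v := (@pabs R p K).
Let hv : nonarchimedean_abs v := pabs_nonarchimedean K.

Lemma is_tame_eval2 (B : set K) H X Y : (forall m, v (mpoly.mcoeff m H) <= 1) ->
  is_tame v B X -> is_tame v B Y -> is_tame v B (fun u => eval2 H (X u) (Y u)).
Proof.
move=> H1 tX tY; under eq_fun do rewrite eval2E.
elim: (mpoly.msupp H) => [|m s IH].
  by under eq_fun do rewrite big_nil; apply: (is_tame_cst hv); rewrite nabs0.
under eq_fun do rewrite big_cons; apply: (is_tameD hv) => //.
apply: (is_tameM hv); first exact: (is_tame_cst hv).
by apply: (is_tameM hv); exact: (is_tameX hv).
Qed.

Lemma is_tame_chart (B : set K) s : (forall a, B a -> v a <= 1) ->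
  is_tame v B (chartX s) /\ is_tame v B (chartY s).
Proof.
move=> B1; have h1 : is_tame v B (fun=> 1) by apply: (is_tame_cst hv); rewrite nabs1.
have hid : is_tame v B id by exact: (is_tame_id hv).
by case: s.
Qed.

Context {d : nat} {F G : mpoly.mpoly 2 K} {phi : P1 K -> P1 K}.
Hypothesis good : good_reduction_form d F G phi.

Let Fn n := eval2 (iter_forms F G n).1.
Let Gn n := eval2 (iter_forms F G n).2.

Let FnS n X Y : Fn n.+1 X Y = eval2 F (Fn n X Y) (Gn n X Y).
Proof. by rewrite /Fn eval2_iter_formsS. Qed.

Let GnS n X Y : Gn n.+1 X Y = eval2 G (Fn n X Y) (Gn n X Y).
Proof. by rewrite /Gn eval2_iter_formsS. Qed.

(** Good reduction says that [(F, G)] preserves the unit sphere of the maximum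
norm; homogeneity extends this to all vectors. *)
Lemma good_norm X Y : ~ (X = 0 /\ Y = 0) ->
  Num.max (v (eval2 F X Y)) (v (eval2 G X Y)) = Num.max (v X) (v Y) ^+ d.
Proof.
move=> /not_andP n0.
have unit U V : v U <= 1 -> v V <= 1 -> (v U = 1) \/ (v V = 1) ->
    Num.max (v (eval2 F U V)) (v (eval2 G U V)) = 1.
  move=> U1 V1 UV.
  have le1 H : (forall m, v (mpoly.mcoeff m H) <= 1) -> v (eval2 H U V) <= 1.
    move=> H1; have [q tq] := @is_tame_eval2 setT H (fun=> U) (fun=> V) H1
      (is_tame_cst hv _ U1) (is_tame_cst hv _ V1).
    exact: (tame_le1 tq (a := 0)).
  have F1 := le1 _ (grf_integralF good); have G1 := le1 _ (grf_integralG good).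
  apply/eqP; rewrite eq_le ge_max F1 G1 /= leNgt gt_max; apply/negP => /andP FG.
  apply: (grf_no_common_root good U1 V1 _ FG) => -[U1' V1'].
  by case: UV => UV; rewrite UV ltxx in U1' V1'.
have scale c U V : c != 0 -> X = c * U -> Y = c * V ->
    v U <= 1 -> v V <= 1 -> (v U = 1) \/ (v V = 1) ->
    Num.max (v (eval2 F X Y)) (v (eval2 G X Y)) = Num.max (v X) (v Y) ^+ d.
  move=> c0 -> -> U1 V1 UV.
  rewrite (eval2_homog _ _ _ (grf_homogF good)) (eval2_homog _ _ _ (grf_homogG good)).
  rewrite !(nabsM hv) -!maxr_pMr ?(nabs_ge0 hv)// unit// mulr1 (nabsX hv).
  suff -> : Num.max (v U) (v V) = 1 by rewrite mulr1.
  by apply/eqP; rewrite eq_le ge_max U1 V1 le_max; case: UV => ->; rewrite lexx ?orbT.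
have [XY|YX] : v X <= v Y \/ v Y < v X by case: ltP => _; [right|left].
  have Y0 : Y != 0.
    apply/eqP => Y0; case: n0 => // X0; apply: X0.
    by apply/(nabs_eq0 hv)/eqP; rewrite eq_le (nabs_ge0 hv) andbT -(nabs0 hv) -Y0.
  apply: (scale Y (X / Y) 1); rewrite ?mulr1 ?(nabs1 hv)//; first by field.
    by rewrite (nabsM hv) (nabsV hv) ler_pdivrMr ?mul1r// nabs_gt0.
  by right.
have X0 : X != 0 by apply: (nabs_neq0 hv); apply: le_lt_trans YX; exact: nabs_ge0.
apply: (scale X 1 (Y / X)); rewrite ?mulr1 ?(nabs1 hv)//; first by field.
  by rewrite (nabsM hv) (nabsV hv) ler_pdivrMr ?mul1r ?nabs_gt0// ltW.
by left.
Qed.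

Lemma norm_neq0 X Y : ~ (X = 0 /\ Y = 0) <-> 0 < Num.max (v X) (v Y).
Proof.
rewrite lt_max; split=> [n0|/orP[] h [X0 Y0]]; last 2 first.
- by rewrite X0 nabs0 ?ltxx in h.
- by rewrite Y0 nabs0 ?ltxx in h.
have [X0|X0] := eqVneq X 0; last by rewrite (nabs_gt0 hv X0).
have [Y0|Y0] := eqVneq Y 0; last by rewrite (nabs_gt0 hv Y0) orbT.
by case: n0.
Qed.

Lemma iter_norm n X Y : ~ (X = 0 /\ Y = 0) ->
  Num.max (v (Fn n X Y)) (v (Gn n X Y)) = Num.max (v X) (v Y) ^+ (d ^ n).
Proof.
move=> n0; elim: n => [|n IH].
  by rewrite /Fn /Gn !eval2_iter_forms0 expn0 expr1.
have n1 : ~ (Fn n X Y = 0 /\ Gn n X Y = 0).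
  by apply/norm_neq0; rewrite IH exprn_gt0//; exact/norm_neq0.
by rewrite FnS GnS expnS mulnC exprM -IH good_norm.
Qed.

Lemma iter_neq0 n X Y : ~ (X = 0 /\ Y = 0) -> ~ (Fn n X Y = 0 /\ Gn n X Y = 0).
Proof.
by move=> n0; apply/norm_neq0; rewrite iter_norm// exprn_gt0//; exact/norm_neq0.
Qed.

Lemma iter_represents n X Y : ~ (X = 0 /\ Y = 0) ->
  iter n phi (P1_of X Y) = P1_of (Fn n X Y) (Gn n X Y).
Proof.
move=> n0; elim: n => [|n IH]; first by rewrite /Fn /Gn !eval2_iter_forms0.
by rewrite iterS IH (grf_represents good) ?FnS ?GnS//; exact: iter_neq0.
Qed.

Lemma is_tame_iter_forms (B : set K) s n : (forall a, B a -> v a <= 1) ->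
  is_tame v B (fun u => Fn n (chartX s u) (chartY s u)) /\
  is_tame v B (fun u => Gn n (chartX s u) (chartY s u)).
Proof.
move=> B1; elim: n => [|n [IF IG]].
  have [tX tY] := is_tame_chart s B1.
  by rewrite /Fn /Gn; split; under eq_fun do rewrite eval2_iter_forms0.
split.
  under eq_fun do rewrite FnS; apply: is_tame_eval2 => //; exact: grf_integralF good.
under eq_fun do rewrite GnS; apply: is_tame_eval2 => //; exact: grf_integralG good.
Qed.

(** An iterate of [phi] which moves the centre of a disc of radius [rho < 1] by at
most [rho] is given there by a tame self-map: the denominator is a unit at the
centre, hence on the whole disc. *)
Lemma chart_iter s M u0 u1 rho : v u0 <= 1 -> v u1 <= 1 -> rho < 1 ->
  v (u1 - u0) <= rho -> iter M phi (chart s u0) = chart s u1 ->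
  let B := [set u | v (u - u0) <= rho] in
  exists f q, [/\ tame v B f q, forall u, B u -> B (f u),
    forall u, B u -> iter M phi (chart s u) = chart s (f u) &
    forall u, B u -> v u <= 1].
Proof.
move=> u01 u11 rho1 u10 Phi01 B.
have rho0 : 0 <= rho := le_trans (nabs_ge0 hv _) u10.
have B1 u : B u -> v u <= 1.
  move=> Bu; rewrite -(subrK u0 u); apply: nabs_leD => //.
  exact: le_trans Bu (ltW rho1).
have Bu0 : B u0 by rewrite /B /= subrr nabs0.
have [tF tG] := is_tame_iter_forms s M B1.
pose A u := Fn M (chartX s u) (chartY s u).
pose C u := Gn M (chartX s u) (chartY s u).
pose Den u := if s then C u else A u.
pose Num u := if s then A u else C u.
have tDen : is_tame v B Den by rewrite /Den; case: (s).
have tNum : is_tame v B Num by rewrite /Num; case: (s).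
have max1 u : B u -> Num.max (v (Num u)) (v (Den u)) = 1.
  move=> Bu; have u_le1 := B1 _ Bu.
  have -> : Num.max (v (Num u)) (v (Den u)) = Num.max (v (A u)) (v (C u)).
    by rewrite /Num /Den; case: (s) => //; rewrite maxC.
  rewrite iter_norm; last exact: chart_neq0.
  suff -> : Num.max (v (chartX s u)) (v (chartY s u)) = 1 by rewrite expr1n.
  by case: (s); rewrite /= nabs1//; [apply/max_idPr|apply/max_idPl].
have chartE u w : Num u = w * Den u -> P1_of (A u) (C u) = chart s w.
  move=> e; apply/P1_of_inj; [exact: iter_neq0 (@chart_neq0 _ _ _)|exact: chart_neq0|].
  by move: e; rewrite /Num /Den /A /C; case: (s) => /= ->; rewrite ?(mulr1, mul1r)// mulrC.
have Num0 : Num u0 = u1 * Den u0.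
  move: Phi01; rewrite iter_represents; last exact: chart_neq0.
  move=> /P1_of_inj -/(_ (iter_neq0 (@chart_neq0 _ _ _)) (@chart_neq0 _ _ _)).
  by rewrite /Num /Den /A /C; case: (s) => /=; rewrite ?(mulr1, mul1r)// mulrC.
have Den0 : v (Den u0) = 1.
  rewrite -(max1 _ Bu0) Num0; apply/esym/max_idPr.
  by apply: nabs_le1M.
have Den1 u : B u -> v (Den u) = 1.
  case: tDen => q tq Bu; rewrite -Den0; apply: (nabs_close hv); rewrite Den0.
  by apply: le_lt_trans (tame_lip hv tq Bu Bu0) _; exact: le_lt_trans Bu rho1.
have [q tq] : is_tame v B (fun u => Num u * (Den u)^-1).
  by apply: (is_tameM hv) => //; exact: (is_tameV hv).
have D0 u : B u -> Den u != 0 by move=> Bu; apply: (nabs_neq0 hv); rewrite Den1.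
exists (fun u => Num u * (Den u)^-1), q; split=> //.
- move=> u Bu; apply: (nabs_dist_trans hv (b := u1)) => //.
  have -> : u1 = Num u0 * (Den u0)^-1 by rewrite Num0 mulfK// D0.
  exact: le_trans (tame_lip hv tq Bu Bu0) Bu.
- move=> u Bu; rewrite iter_represents; last exact: chart_neq0.
  by apply: chartE; rewrite divfK// D0.
Qed.

End GoodReduction.

(** * Periodic points *)

Section LeastPeriod.
Variables (T : Type) (phi : T -> T).

Lemma least_period_le n N y : least_period phi n y -> (0 < N)%N ->
  iter N phi y = y -> (n <= N)%N.
Proof.
move=> [_ cn] N0 yN; rewrite -card_le_II -(card_le_eql cn).
apply: card_le_trans (card_image_le (fun k => iter k phi y) `I_N).
apply: subset_card_le => _ [k _ <-]; exists (k %% N)%N; first by rewrite /= ltn_mod.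
rewrite [in RHS](divn_eq k N) addnC iterD; congr iter.
by rewrite iterM; elim: (k %/ N)%N => //= i <-.
Qed.

Lemma least_period_inj n m y : least_period phi n y -> least_period phi m y -> n = m.
Proof.
by move=> [_ cn] [_ cm]; apply/card_eq_II; rewrite -(card_eql cn).
Qed.

End LeastPeriod.

Section Returns.
Context {R : realType} {p : nat} {K : Qp_closure R p}.
Hypothesis p_prime : prime p.
Local Notation v := (@pabs R p K).
Let hv : nonarchimedean_abs v := pabs_nonarchimedean K.
Context {d : nat} {F G : mpoly.mpoly 2 K} {phi : P1 K -> P1 K}.
Hypothesis good : good_reduction_form d F G phi.

Let iter_chart (B : set K) s M f j u : (forall u, B u -> B (f u)) ->
  (forall u, B u -> iter M phi (chart s u) = chart s (f u)) -> B u ->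
  iter (j * M) phi (chart s u) = chart s (iter j f u).
Proof.
move=> fB fE Bu; rewrite iterM; elim: j => //= j ->; apply: fE.
by elim: j => //= j /fB.
Qed.

(** If two distinct periodic points lie in the same small disc, a common iterate
of [phi] fixes both, so that its divided difference at these points is [1]: it
is close to the identity on the disc, and by [tame_return_lb] the periodic
points of the disc have bounded periods. *)
Lemma periodic_leave_disc (y : nat -> K) s c rho : v c <= 1 -> rho < 1 ->
  (forall n, (0 < n)%N -> least_period phi n (Some (y n))) ->
  exists N, forall n u, (N <= n)%N -> chart s u = Some (y n) -> rho < v (u - c).
Proof.
move=> c1 rho1 yP.
pose S n := exists u, chart s u = Some (y n) /\ v (u - c) <= rho.
have [[n0 [n1 [n00 n10 n01 [w0 [w0E w0c]] [w1 [w1E w1c]]]]]|few] :=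
  pselect (exists n0 n1, [/\ (0 < n0)%N, (0 < n1)%N, n0 != n1, S n0 & S n1]); last first.
  have [[n0 [n00 Sn0]]|none] := pselect (exists n, (0 < n)%N /\ S n).
    exists n0.+1 => n u n0n uE; rewrite ltNge; apply/negP => uc.
    apply: few; exists n0, n; split=> //; last by exists u.
      exact: leq_ltn_trans n0n.
    by rewrite ltn_eqF.
  exists 1%N => n u n0 uE; rewrite ltNge; apply/negP => uc.
  by apply: none; exists n; split=> //; exists u.
have rho0 : 0 <= rho := le_trans (nabs_ge0 hv _) w0c.
have [[m0 m00 m0P] _] := yP _ n00; have [[m1 m10 m1P] _] := yP _ n10.
have w01 : w0 != w1.
  apply: contra_neq n01 => w01; apply: (least_period_inj (yP _ n00)).
  by rewrite -w0E w01 w1E; exact: yP.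
have fix_mul m j z : iter m phi z = z -> iter (j * m) phi z = z.
  by move=> mz; rewrite iterM; elim: j => //= j ->.
pose M := (m0 * m1)%N.
have M0 : iter M phi (chart s w0) = chart s w0 by rewrite w0E /M mulnC fix_mul.
have M1 : iter M phi (chart s w1) = chart s w1 by rewrite w1E fix_mul.
have w0_le1 : v w0 <= 1.
  by rewrite -(subrK c w0); apply: nabs_leD => //; exact: le_trans w0c (ltW rho1).
have w00 : v (w0 - w0) <= rho by rewrite subrr nabs0.
have [f [q [tf fB fE B1]]] := chart_iter good w0_le1 w0_le1 rho1 w00 M0.
set B := [set u | v (u - w0) <= rho] in tf fB fE B1.
have Bc u : v (u - c) <= rho -> B u.
  by move=> uc; apply: (nabs_dist_trans hv uc); rewrite nabsBC.
have Bw0 := Bc _ w0c; have Bw1 := Bc _ w1c.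
have q01 : q w0 w1 = 1.
  apply: (mulIf (x := w0 - w1)); first by rewrite subr_eq0.
  rewrite -(tame_dd tf Bw0 Bw1) mul1r.
  by rewrite (chart_inj (etrans (esym (fE _ Bw0)) M0)) (chart_inj (etrans (esym (fE _ Bw1)) M1)).
have dB a b : B a -> B b -> v (a - b) <= rho.
  by move=> Ba Bb; apply: (nabs_dist_trans hv Ba); rewrite nabsBC.
have [||N N0 HN] := tame_return_lb hv (prime_gt0 p_prime)
  (pabs_nat_gt0 p_prime (prime_gt0 p_prime)) (pabs_p_lt1 p_prime)
  (@pabs_p_le_prime _ _ K p_prime) fB B1 tf rho0 rho1.
- by move=> a b Ba Bb; rewrite -q01; apply: (tame_dd_lip tf) => //; exact: dB.
- by move=> a Ba; apply: dB => //; exact: fB.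
exists (N * M).+1 => n u Nn uE; rewrite ltNge; apply/negP => /Bc Bu.
have n_gt0 : (0 < n)%N by exact: leq_ltn_trans Nn.
have [[m m_gt0 mP] _] := yP _ n_gt0.
have fix_u : iter N f u = u.
  apply/eqP; rewrite -subr_eq0; apply/eqP/(nabs_eq0 hv)/eqP.
  rewrite eq_le (nabs_ge0 hv) andbT.
  have := HN u m Bu m_gt0.
  have -> : iter (N * m) f u = u.
    apply: (@chart_inj _ s); rewrite -(iter_chart _ fB fE Bu) uE.
    by rewrite mulnAC fix_mul.
  rewrite subrr nabs0// => h.
  by rewrite -(pmulr_rle0 _ (@pabs_nat_gt0 _ _ K p_prime _ m_gt0)) h.
have := least_period_le (yP _ n_gt0) (N := (N * M)%N) _ _.
rewrite -uE (iter_chart _ fB fE Bu) fix_u !muln_gt0 N0 m00 m10 => /(_ isT erefl).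
by rewrite leqNgt Nn.
Qed.

(** Two points of the same chart which are not congruent modulo the maximal
ideal are at distance [1], so that only close returns have to be bounded. The
bound for the iterate [n * (m * J)], given by [tame_recurrence_lb] for
[phi ^ m], is carried over to the iterate [n], as [phi ^ n] does not expand. *)
Lemma nonperiodic_return_lb s u0 : v u0 <= 1 -> ~ periodic_point phi (chart s u0) ->
  exists2 c : R, 0 < c & forall n u1, (0 < n)%N -> v u1 <= 1 -> v (u1 - u0) < 1 ->
    iter n phi (chart s u0) = chart s u1 -> c / n%:R <= v (u1 - u0).
Proof.
move=> u01 aper.
have [[m [um [m0 um1 umu um_ret]]]|never] := pselect (exists m um,
  [/\ (0 < m)%N, v um <= 1, v (um - u0) < 1 & iter m phi (chart s u0) = chart s um]); last first.
  by exists 1 => // n u1 n0 u11 u1u u1r; case: never; exists n, u1.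
have [f [q [tf fB fE B1]]] := chart_iter good u01 um1 umu (lexx _) um_ret.
set B := [set u | v (u - u0) <= _] in tf fB fE B1.
have Bu0 : B u0 by rewrite /B /= subrr nabs0// nabs_ge0.
have [|J [c [J0 c0 HJ]]] := tame_recurrence_lb hv (prime_gt0 p_prime)
  (pabs_nat_gt0 p_prime (prime_gt0 p_prime)) (pabs_p_lt1 p_prime)
  (@pabs_p_le_prime _ _ K p_prime) (nabs_ge0 hv _) umu B1 fB tf.
  move=> j j0; apply: contra_notN aper => /eqP fj.
  exists (j * m)%N; first by rewrite muln_gt0 j0.
  by rewrite (iter_chart _ fB fE Bu0) fj.
exists c => // n u1 n0 u11 u1u u1_ret.
have [f' [q' [tf' fB' fE' B1']]] := chart_iter good u01 u11 u1u (lexx _) u1_ret.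
set B' := [set u | v (u - u0) <= _] in tf' fB' fE' B1'.
have Bu0' : B' u0 by rewrite /B' /= subrr nabs0// nabs_ge0.
have same : iter (m * J) f' u0 = iter (J * n) f u0.
  apply: (@chart_inj _ s).
  rewrite -(iter_chart _ fB fE Bu0) -(iter_chart _ fB' fE' Bu0').
  by congr (iter _ _ _); rewrite -mulnA mulnC.
have iB' k : B' (iter k f' u0) by elim: k => //= k /fB'.
apply: le_trans (iB' (m * J)%N); rewrite same.
apply: le_trans (HJ n n0); rewrite ler_wpM2l ?(ltW c0)//.
exact: pabs_nat_lb.
Qed.

(** [W] is the chordal distance from a point to its image. When it is less than
[1], the image lies in the same chart, where chordal distance is ordinary
distance. *)
Lemma near_return_chart n s u0 : v u0 <= 1 ->
  let A := eval2 (iter_forms F G n).1 (chartX s u0) (chartY s u0) in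
  let C := eval2 (iter_forms F G n).2 (chartX s u0) (chartY s u0) in
  let W := v (A * chartY s u0 - C * chartX s u0) in
  W < 1 ->
  exists u1, [/\ v u1 <= 1, v (u1 - u0) = W & iter n phi (chart s u0) = chart s u1].
Proof.
move=> u01 A C W W1.
have n0 := @chart_neq0 K s u0.
have max1 : Num.max (v A) (v C) = 1.
  rewrite (iter_norm good)//.
  suff -> : Num.max (v (chartX s u0)) (v (chartY s u0)) = 1 by rewrite expr1n.
  by case: (s); rewrite /= nabs1//; [apply/max_idPr|apply/max_idPl].
pose Den := if s then C else A.
pose Num := if s then A else C.
have WE : W = v (Num - Den * u0).
  rewrite /W /Num /Den; case: (s) => /=; rewrite ?mulr1//.
  by rewrite (nabsBC hv).
have maxND : Num.max (v Num) (v Den) = 1.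
  by rewrite /Num /Den -max1; case: (s); rewrite // maxC.
have D1 : v Den = 1.
  apply/eqP; rewrite eq_le -{1}maxND le_max lexx orbT /=.
  rewrite leNgt; apply/negP => D1.
  have : v Num < 1.
    apply: le_lt_trans (_ : Num.max W (v Den) < 1); last by rewrite gt_max W1.
    rewrite WE -{1}(subrK (Den * u0) Num).
    apply: le_trans (nabsD hv _ _) _; rewrite ge_max le_max lexx /= le_max.
    by apply/orP; right; exact: nabs_leM1.
  by move=> N1; have := ltxx (1 : R); rewrite -{1}maxND gt_max N1 D1.
have D0 : Den != 0 by apply: (nabs_neq0 hv); rewrite D1.
exists (Num / Den); split.
- by rewrite (nabsM hv) (nabsV hv) D1 invr1 mulr1 -maxND le_max lexx.
- rewrite WE -[LHS]mulr1 -D1 -(nabsM hv); congr v.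
  by field.
- rewrite /chart (iter_represents good)//; apply/P1_of_inj.
  + exact: (iter_neq0 good).
  + exact: chart_neq0.
  + move: D0; rewrite /Num /Den -/A -/C; case: (s) => /= D0; by field.
Qed.

End Returns.

(** * The local height *)

Section LocalHeight.
Context {R : realType} {p : nat} {K : Qp_closure R p}.
Hypothesis p_prime : prime p.
Local Notation v := (@pabs R p K).
Let hv : nonarchimedean_abs v := pabs_nonarchimedean K.
Context {d : nat} {F G : mpoly.mpoly 2 K} {phi : P1 K -> P1 K}.
Hypothesis good : good_reduction_form d F G phi.

Lemma horner_denom n t : (denom F G n).[t] = eval2 (iter_forms F G n).1 1 t.
Proof. exact: horner_dehomog. Qed.

Lemma horner_numer n t : (numer F G n).[t] = eval2 (iter_forms F G n).2 1 t.
Proof. exact: horner_dehomog. Qed.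

Lemma iter_phi_affine n t :
  iter n phi (Some t) = P1_of (denom F G n).[t] (numer F G n).[t].
Proof.
rewrite chart_Some /chart (iter_represents good) ?horner_denom ?horner_numer//.
exact: (@chart_neq0 _ false t).
Qed.

Lemma affine_norm n t : Num.max (v (denom F G n).[t]) (v (numer F G n).[t]) =
  Num.max 1 (v t) ^+ (d ^ n).
Proof.
rewrite horner_denom horner_numer (iter_norm good) ?(nabs1 hv)//.
exact: (@chart_neq0 _ false t).
Qed.

Lemma affine_neq0 n t : (denom F G n).[t] = 0 -> (numer F G n).[t] = 0 -> False.
Proof.
move=> D0 N0; have := affine_norm n t; rewrite D0 N0 (nabs0 hv) maxxx => /esym/eqP.
by rewrite gt_eqF// exprn_gt0// lt_max ltr01.
Qed.

Lemma root_fixed n t : root (numer F G n - 'X * denom F G n) t <->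
  iter n phi (Some t) = Some t.
Proof.
rewrite iter_phi_affine /P1_of /root !hornerE subr_eq0.
have [D0|D0] := eqVneq (denom F G n).[t] 0.
  by rewrite D0 mulr0; split=> // /eqP /(affine_neq0 D0).
split=> [/eqP ->|[] e]; first by rewrite mulfK.
by rewrite -{2}e divfK.
Qed.

Lemma max1_gt0 (a : R) : 0 < Num.max 1 a.
Proof. by rewrite lt_max ltr01. Qed.

(** Preservation of the maximum norm is exactly the functional equation of the
local height for [log_plus]. *)
Lemma log_plus_is_local_height : is_local_height d F G phi (fun t => log_plus (v t)).
Proof.
split.
- by exists 0 => t; rewrite subrr normr0.
- by move=> t e e0; exists 1 => // s _; rewrite !subrr normr0.
- move=> t u D0; rewrite -[phi _]/(iter 1 phi _) iter_phi_affine /P1_of (negbTE D0) => -[<-].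
  have := affine_norm 1 t; rewrite expn1.
  move: D0; set D := (denom F G 1).[t]; set N := (numer F G 1).[t] => D0 DN.
  have vD := nabs_gt0 hv D0.
  have E : Num.max 1 (v (N / D)) * v D = Num.max 1 (v t) ^+ d.
    by rewrite -DN maxr_pMl ?(nabs_ge0 hv)// mul1r -(nabsM hv) divfK.
  have := congr1 (@ln R) E; rewrite lnM ?posrE ?max1_gt0// lnXn ?max1_gt0// => e.
  by rewrite /log_plus mulr_natl -e addrK.
Qed.

Lemma dense_nonroot (P : {poly K}) (t : K) (r : R) : P != 0 -> 0 < r ->
  exists2 s, v (s - t) < r & P.[s] != 0.
Proof.
move=> P0 r0.
have [k pk] : exists k, v (p%:R ^+ k) < r.
  have /cvgrPdist_lt /(_ _ r0) [k _ /(_ k)] := @cvg_expr R (v p%:R)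
    (ltac:(by rewrite ger0_norm ?(nabs_ge0 hv)// pabs_p_lt1)).
  rewrite /= sub0r normrN ger0_norm ?exprn_ge0 ?(nabs_ge0 hv)// => /(_ (leqnn _)).
  by exists k; rewrite nabsX.
have p0 : p%:R != 0 :> K.
  by apply: (nabs_neq0 hv); rewrite pabs_nat_gt0// prime_gt0.
apply: contrapT => none.
have roots i : root P (t + p%:R ^+ k * i%:R).
  apply/eqP; apply: contrapT => /eqP Pi; apply: none; exists (t + p%:R ^+ k * i%:R) => //.
  rewrite (addrC t) addrK; apply: le_lt_trans pk.
  by apply: nabs_leM1 => //; exact: nabs_nat.
have nat_inj : injective (fun i : nat => i%:R : K).
  move=> i j; wlog ij : i j / (i <= j)%N => [wl|].
    by move=> e; case/orP: (leq_total i j) => h; [exact: wl|apply/esym/wl].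
  move=> /esym/eqP; rewrite -subr_eq0 -natrB// => e.
  apply/eqP; rewrite eqn_leq ij /= -subn_eq0 -leqn0 leqNgt; apply/negP.
  by move=> /(@pabs_nat_gt0 _ _ K p_prime) /(nabs_neq0 hv); rewrite e.
have := @max_poly_roots _ P [seq t + p%:R ^+ k * i%:R | i <- iota 0 (size P)] P0.
rewrite size_map size_iota ltnn => h; suff : false by [].
apply: h; first by apply/allP => _ /mapP [i _ ->].
rewrite map_inj_uniq ?iota_uniq// => i j /addrI /(mulfI (expf_neq0 k p0)).
exact: nat_inj.
Qed.

(** The difference [del] of two local heights is bounded, continuous and satisfies
[del (phi t) = d * del t] away from the poles of [phi]. Its supremum [S] thus
satisfies [S <= S / d]; continuity takes care of the poles, which have empty
interior. *)
Lemma local_height_unique lam : (1 < d)%N -> denom F G 1 != 0 ->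
  is_local_height d F G phi lam -> forall t, lam t = log_plus (v t).
Proof.
move=> d1 D0 [[M hM] hc he] t0.
have d_gt1 : (1 : R) < d%:R by rewrite ltr1n.
have d_gt0 : (0 : R) < d%:R by rewrite ltr0n; exact: ltnW.
pose del t := lam t - log_plus (v t).
have [_ _ hl] := log_plus_is_local_height.
have del_eq t u : (denom F G 1).[t] != 0 -> phi (Some t) = Some u ->
    del u = d%:R * del t.
  by move=> t1 tu; rewrite /del (he _ _ t1 tu) (hl _ _ t1 tu); ring.
pose E := [set `|del t| | t in setT].
have Eub : has_sup E.
  by split; [exists `|del t0|, t0|exists M => _ [t _ <-]; exact: hM].
set S := sup E.
have leS t : `|del t| <= S by apply: sup_upper_bound => //; exists t.
have leSd_pole t : (denom F G 1).[t] != 0 -> `|del t| <= S / d%:R.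
  move=> Dt; rewrite ler_pdivlMr//.
  have [u tu] : exists u, phi (Some t) = Some u.
    rewrite -[phi _]/(iter 1 phi _) iter_phi_affine /P1_of (negbTE Dt).
    by eexists.
  by have := leS u; rewrite (del_eq _ _ Dt tu) normrM gtr0_norm// mulrC.
have leSd t : `|del t| <= S / d%:R.
  apply/ler_addgt0Pr => e e0; have [r r0 hr] := hc t e e0.
  have [s st Ds] := dense_nonroot t D0 r0.
  rewrite -(subrK (del s) (del t)); apply: le_trans (ler_normD _ _) _.
  by rewrite addrC lerD// ?leSd_pole// distrC ltW// hr.
have S_le : S <= S / d%:R.
  by apply: ge_sup; [exists `|del t0|, t0|move=> _ [t _ <-]].
have S0 : S <= 0.
  rewrite leNgt; apply/negP => S_gt0; move: S_le.
  by rewrite ler_pdivlMr// ger_pMr// leNgt d_gt1.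
by have := le_trans (leS t0) S0; rewrite normr_le0 subr_eq0 => /eqP.
Qed.

Lemma local_heightE x : (1 < d)%N -> denom F G 1 != 0 ->
  local_height d F G phi x = log_plus (v x).
Proof.
move=> d1 D0; rewrite /local_height; case: xgetP => [lam _ hlam|none].
  exact: local_height_unique.
by case: (none (fun t => log_plus (v t))); exact: log_plus_is_local_height.
Qed.

End LocalHeight.

(** * Chordal distance and limits *)

Section Limits.
Context {R : realType}.
Implicit Types (a : nat -> R).

Lemma cvg_to_1 a : (forall n, a n <= 1) ->
  (forall r, r < 1 -> exists N, forall n, (N <= n)%N -> r < a n) ->
  a n @[n --> \oo] --> (1 : R).
Proof.
move=> a1 ha; apply/cvgrPdist_lt => e e0.
have [|N hN] := ha (1 - e); first by rewrite gtrBl.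
exists N => // n /= /hN Nn; rewrite ger0_norm ?subr_ge0//.
by rewrite ltrBlDl -ltrBlDr.
Qed.

Lemma cvg_ln_to_0 a : a n @[n --> \oo] --> (1 : R) ->
  ln (a n) @[n --> \oo] --> (0 : R).
Proof. by move=> a1; rewrite -ln1; apply: (continuous_cvg _ _ a1); exact: continuous_ln. Qed.

Lemma sqr_le_exp2 n : (n * n <= 4 * 2 ^ n)%N.
Proof.
have [n4|] := leqP 4 n; last by case: n => [|[|[|[|]]]].
elim: n n4 => // n IH; rewrite leq_eqVlt => /orP[/eqP <-//|n4].
have := IH n4; rewrite expnS; nia.
Qed.

(** A bound [c / n] from below is negligible on the scale [d ^ n]. *)
Lemma cvg_ln_weighted (d : nat) a (c : R) : (1 < d)%N -> 0 < c ->
  (forall n, (0 < n)%N -> c / n%:R <= a n <= 1) ->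
  (d ^ n)%:R^-1 * ln (a n) @[n --> \oo] --> (0 : R).
Proof.
move=> d1 c0 ha; pose C := 8 * (1 + `|ln c|).
have C0 : 0 <= C by rewrite mulr_ge0// addr_ge0.
have harm : C * harmonic n @[n --> \oo] --> (0 : R).
  by rewrite -[X in _ --> X](mulr0 C); apply: cvgMr => //; exact: cvg_harmonic.
have harmN : - (C * harmonic n) @[n --> \oo] --> (0 : R).
  by rewrite -oppr0; exact: cvgN.
apply: (squeeze_cvgr _ harmN harm).
exists 1%N => // n /= n0; rewrite -ler_norml.
have [can an1] := andP (ha n n0).
have n0' : (0 : R) < n%:R by rewrite ltr0n.
have a0 : 0 < a n by apply: lt_le_trans can; rewrite divr_gt0.
have dn0 : (0 : R) < (d ^ n)%:R by rewrite ltr0n expn_gt0 ltnW.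
rewrite normrM gtr0_norm ?invr_gt0// ler0_norm ?ln_le0//.
have lnb : - ln (a n) <= (1 + `|ln c|) * n%:R.
  have h1 : ln c - ln n%:R <= ln (a n).
    rewrite -lnV ?posrE// -lnM ?posrE ?invr_gt0//.
    by rewrite ler_ln ?posrE// divr_gt0.
  have h2 : ln n%:R <= n%:R :> R.
    by apply: le_trans (ltW (ln_sublinear _)).
  have h3 : - ln c <= `|ln c| * n%:R.
    apply: le_trans (_ : `|ln c| <= _); first by rewrite -normrN ler_norm.
    by rewrite ler_peMr// ler1n.
  lra.
(* The constant 8 in C comes from n (n + 1) <= 2 n ^ 2 and n ^ 2 <= 4 * 2 ^ n. *)
have sq : (n.+1 * n <= 8 * d ^ n)%N.
  have := sqr_le_exp2 n.
  have := leq_exp2r 2 d n0; rewrite d1 => h2d h4; nia.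
rewrite ler_pdivrMl//; apply: le_trans lnb _.
rewrite /C /harmonic /= mulrA ler_pdivlMr ?ltr0n//.
set D := 1 + _; have D0 : 0 <= D by rewrite addr_ge0.
rewrite -mulrA -natrM [leRHS](_ : _ = D * (8 * d ^ n)%:R); last by rewrite natrM; ring.
by rewrite ler_wpM2l// ler_nat mulnC.
Qed.

End Limits.

Section Chordal.
Context {R : realType} {p : nat} {K : Qp_closure R p}.
Hypothesis p_prime : prime p.
Local Notation v := (@pabs R p K).
Let hv : nonarchimedean_abs v := pabs_nonarchimedean K.
Context {d : nat} {F G : mpoly.mpoly 2 K} {phi : P1 K -> P1 K}.
Hypothesis good : good_reduction_form d F G phi.

Let m1 (a : K) := Num.max 1 (v a).

Let m1_gt0 a : 0 < m1 a. Proof. exact: max1_gt0. Qed.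
Let m1_ge1 a : 1 <= m1 a. Proof. by rewrite le_max lexx. Qed.
Let m1_gev a : v a <= m1 a. Proof. by rewrite le_max lexx orbT. Qed.

Lemma chordal_le1 x z : v (x - z) / (m1 x * m1 z) <= 1.
Proof.
rewrite ler_pdivrMr ?mulr_gt0// mul1r; apply: nabs_leB => //.
  by apply: le_trans (m1_gev x) _; rewrite ler_peMr// ltW.
by apply: le_trans (m1_gev z) _; rewrite ler_peMl// ltW.
Qed.

Lemma m1_small a : v a <= 1 -> m1 a = 1. Proof. by move/max_idPl. Qed.
Lemma m1_large a : 1 < v a -> m1 a = v a. Proof. by move/ltW/max_idPr. Qed.

Variable y : nat -> K.
Hypothesis yP : forall n, (0 < n)%N -> least_period phi n (Some (y n)).

(** Away from chordal distance [1], the points [x] and [y n] lie in the same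
chart, and there [periodic_leave_disc] applies. *)
Lemma chordal_lb x r : r < 1 -> exists N, forall n, (N <= n)%N ->
  r < v (x - y n) / (m1 x * m1 (y n)).
Proof.
move=> r1; have [x1|x1] := leP (v x) 1.
  have [N hN] := periodic_leave_disc p_prime good false x1 r1 yP.
  exists N => n Nn; rewrite (m1_small x1) mul1r.
  have [y1|y1] := leP (v (y n)) 1.
    rewrite (m1_small y1) divr1 (nabsBC hv).
    by apply: hN Nn _; rewrite -chart_Some.
  rewrite (m1_large y1) (nabsBC hv).
  rewrite (nabs_close hv (a := y n - x) (b := y n)); last first.
    by rewrite addrC addKr (nabsN hv); exact: le_lt_trans x1 y1.
  by rewrite divff// gt_eqF// (lt_trans ltr01).
have x0 : x != 0 by apply: (nabs_neq0 hv); exact: lt_trans x1.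
have xV1 : v x^-1 <= 1 by rewrite (nabsV hv) invf_le1 ?(lt_trans ltr01)// ltW.
have [N hN] := periodic_leave_disc p_prime good true xV1 r1 yP.
exists N => n Nn; rewrite (m1_large x1).
have [y1|y1] := leP (v (y n)) 1.
  rewrite (m1_small y1) mulr1 (nabs_close hv (a := x - y n) (b := x)); last first.
    by rewrite addrC addKr (nabsN hv); exact: le_lt_trans y1 x1.
  by rewrite divff// gt_eqF// (lt_trans ltr01).
have y0 : y n != 0 by apply: (nabs_neq0 hv); exact: lt_trans y1.
rewrite (m1_large y1) -(nabsM hv) -(nabsV hv) -(nabsM hv).
have -> : (x - y n) / (x * y n) = (y n)^-1 - x^-1 by field; rewrite x0.
by apply: hN Nn _; rewrite -chart_SomeV.
Qed.

Lemma chordal_infty_lb r : r < 1 -> exists N, forall n, (N <= n)%N -> r < (m1 (y n))^-1.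
Proof.
move=> r1; have v01 : v 0 <= 1 by rewrite (nabs0 hv).
have [N hN] := periodic_leave_disc p_prime good true v01 r1 yP.
exists N => n Nn; have [y1|y1] := leP (v (y n)) 1; first by rewrite (m1_small y1) invr1.
have y0 : y n != 0 by apply: (nabs_neq0 hv); exact: lt_trans y1.
rewrite (m1_large y1) -(nabsV hv) -[(y n)^-1]subr0.
by apply: hN Nn _; rewrite -chart_SomeV.
Qed.

Lemma chordal_cvg x : v (x - y n) / (m1 x * m1 (y n)) @[n --> \oo] --> (1 : R).
Proof. by apply: cvg_to_1 => [n|r]; [exact: chordal_le1|exact: chordal_lb]. Qed.

(** This is the chordal limit at the point at infinity. *)
Lemma log_plus_period_cvg : log_plus (v (y n)) @[n --> \oo] --> (0 : R).
Proof.
have : (m1 (y n))^-1 @[n --> \oo] --> (1 : R).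
  apply: cvg_to_1 => [n|r]; last exact: chordal_infty_lb.
  by rewrite invf_le1.
move=> /cvg_ln_to_0 /cvgN; rewrite oppr0; apply: cvg_trans.
apply: near_eq_cvg; near=> n.
by rewrite /= fctE /= lnV ?posrE// opprK.
Unshelve. all: by end_near. Qed.

Lemma ln_dist_period_cvg x :
  ln (v (x - y n)) @[n --> \oo] --> log_plus (v x).
Proof.
have h1 := cvg_ln_to_0 (chordal_cvg x).
have h2 := log_plus_period_cvg.
have : ln (v (x - y n) / (m1 x * m1 (y n))) + log_plus (v (y n)) + log_plus (v x)
    @[n --> \oo] --> (0 : R) + 0 + log_plus (v x).
  by apply: cvgD; [exact: cvgD|exact: cvg_cst].
rewrite !add0r; apply: cvg_trans; apply: near_eq_cvg.
have [N hN] := chordal_lb x (ltr01 : (0 : R) < 1).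
exists N => // n /= /hN; rewrite pmulr_lgt0 ?invr_gt0 ?mulr_gt0// => v0.
by rewrite ln_div ?posrE ?mulr_gt0// lnM ?posrE// /log_plus -/(m1 _) -/(m1 _); ring.
Qed.

Lemma iter_forms_homog n c X Y :
  (eval2 (iter_forms F G n).1 (c * X) (c * Y) =
    c ^+ (d ^ n) * eval2 (iter_forms F G n).1 X Y) *
  (eval2 (iter_forms F G n).2 (c * X) (c * Y) =
    c ^+ (d ^ n) * eval2 (iter_forms F G n).2 X Y).
Proof.
elim: n => [|n [IF IG]]; first by rewrite !eval2_iter_forms0 expn0 expr1.
rewrite !eval2_iter_formsS IF IG expnS mulnC exprM.
by rewrite (eval2_homog _ _ _ (grf_homogF good)) (eval2_homog _ _ _ (grf_homogG good)).
Qed.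

(** [b n] is the chordal distance from [x] to [phi ^ n (x)]. *)
Lemma period_polynomial_size x : ~ periodic_point phi (Some x) ->
  exists b (c : R), [/\ 0 < c, forall n, (0 < n)%N -> c / n%:R <= b n <= 1 &
    forall n, v ((numer F G n).[x] - x * (denom F G n).[x]) = b n * m1 x ^+ (d ^ n).+1].
Proof.
move=> aper.
have [s [u0 [u01 xE k0 kE]]] : exists s u0, [/\ v u0 <= 1, Some x = chart s u0,
    m1 x = v (if s then x else 1) &
    (1 = (if s then x else 1) * chartX s u0) /\ (x = (if s then x else 1) * chartY s u0)].
  have [x1|x1] := leP (v x) 1.
    exists false, x; split=> //; first exact: chart_Some.
      by rewrite m1_small// (nabs1 hv).
    by rewrite /= !mul1r.
  have x0 : x != 0 by apply: (nabs_neq0 hv); exact: lt_trans x1.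
  exists true, x^-1; split.
  - by rewrite (nabsV hv) invf_le1 ?(lt_trans ltr01)// ltW.
  - exact: chart_SomeV.
  - exact: m1_large.
  - by rewrite /= mulr1 divff.
set k := (if s then x else 1) in k0 kE.
have aper' : ~ periodic_point phi (chart s u0) by rewrite -xE.
have [c c0 hc] := nonperiodic_return_lb p_prime good u01 aper'.
pose A n := eval2 (iter_forms F G n).1 (chartX s u0) (chartY s u0).
pose C n := eval2 (iter_forms F G n).2 (chartX s u0) (chartY s u0).
pose W n := v (A n * chartY s u0 - C n * chartX s u0).
have W1 n : W n <= 1.
  have n0 := @chart_neq0 K s u0.
  have : Num.max (v (A n)) (v (C n)) = 1.
    rewrite (iter_norm good)//.
    suff -> : Num.max (v (chartX s u0)) (v (chartY s u0)) = 1 by rewrite expr1n.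
    by case: (s); rewrite /= nabs1//; [apply/max_idPr|apply/max_idPl].
  move=> max1; have /andP [vA vC] : (v (A n) <= 1) && (v (C n) <= 1) by rewrite -ge_max max1.
  by apply: nabs_leB => //; apply: nabs_leM1 => //; case: (s); rewrite //= nabs1.
exists W, (Num.min c 1); split.
- by rewrite lt_min c0 ltr01.
- move=> n n0; rewrite W1 andbT.
  have n0' : (0 : R) < n%:R by rewrite ltr0n.
  have [Wlt|Wge] := ltP (W n) 1.
    have [u1 [u11 u1W u1r]] := near_return_chart good u01 Wlt.
    rewrite -/(A n) -/(C n) -/(W n) in u1W.
    apply: le_trans (_ : c / n%:R <= _).
      by rewrite ler_pM2r ?invr_gt0// ge_min lexx.
    by rewrite -u1W hc// u1W.
  apply: le_trans Wge; rewrite ler_pdivrMr// mul1r.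
  by apply: le_trans (_ : 1 <= _); rewrite ?ge_min ?lexx ?orbT// ler1n.
- move=> n; case: kE => k1 kx.
  rewrite horner_numer horner_denom.
  have -> : eval2 (iter_forms F G n).1 1 x = k ^+ (d ^ n) * A n.
    by rewrite /A -iter_forms_homog -k1 -kx.
  have -> : eval2 (iter_forms F G n).2 1 x = k ^+ (d ^ n) * C n.
    by rewrite /C -iter_forms_homog -k1 -kx.
  have -> : k ^+ (d ^ n) * C n - x * (k ^+ (d ^ n) * A n) =
      - ((A n * chartY s u0 - C n * chartX s u0) * k ^+ (d ^ n).+1).
    by rewrite -[in LHS](mul1r (_ * C n)) {1}k1 {1}kx exprS; ring.
  by rewrite (nabsN hv) (nabsM hv) (nabsX hv) -k0.
Qed.

Lemma period_polynomial_cvg x : (1 < d)%N -> ~ periodic_point phi (Some x) ->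
  (d ^ n)%:R^-1 * ln (v ((numer F G n).[x] - x * (denom F G n).[x]))
    @[n --> \oo] --> log_plus (v x).
Proof.
move=> d1 /period_polynomial_size [b [c [c0 hb bE]]].
have h1 := cvg_ln_weighted d1 c0 hb.
have h2 : (d ^ n)%:R^-1 @[n --> \oo] --> (0 : R).
  have : (d%:R^-1 : R) ^+ n @[n --> \oo] --> (0 : R).
    apply: cvg_expr; rewrite ger0_norm ?invr_ge0//.
    by rewrite invf_lt1 ?ltr1n// ltr0n ltnW.
  by under eq_fun do rewrite exprVn -natrX.
have : (d ^ n)%:R^-1 * ln (b n) + (1 + (d ^ n)%:R^-1) * log_plus (v x)
    @[n --> \oo] --> (0 : R) + (1 + 0) * log_plus (v x).
  apply: cvgD => //; apply: cvgMl; apply: cvgD => //; exact: cvg_cst.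
rewrite addr0 mul1r add0r; apply: cvg_trans; apply: near_eq_cvg.
exists 1%N => // n /= n0; have /andP [cb _] := hb n n0.
have b0 : 0 < b n by apply: lt_le_trans cb; rewrite divr_gt0// ltr0n.
have dn0 : (d ^ n)%:R != 0 :> R by rewrite pnatr_eq0 expn_eq0 -leqn0 leqNgt ltnW.
rewrite bE lnM ?posrE ?exprn_gt0// lnXn// /log_plus -/(m1 _) -[ln _ *+ _]mulr_natl -natr1.
by field.
Qed.

End Chordal.

Theorem theorem3 (R : realType) (p : nat) (p_prime : prime p)
    (K : Qp_closure R p) (d : nat) (d_gt1 : (1 < d)%N)
    (F G : mpoly.mpoly 2 K) (phi : P1 K -> P1 K)
    (good : good_reduction_form d F G phi)
    (fixed_infty : phi None = None)
    (x : K) (y : nat -> K)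
    (y_period : forall n : nat, (0 < n)%N -> least_period phi n (Some (y n))) :
  [/\ (pabs (x - y n) / (Num.max 1 (pabs x) * Num.max 1 (pabs (y n)))
        @[n --> \oo] --> (1 : R)),
      local_height d F G phi x = log_plus (pabs x),
      (ln (pabs (x - y n)) @[n --> \oo] --> local_height d F G phi x),
      (~ periodic_point phi (Some x) ->
        (d ^ n)%:R^-1 *
          ln (pabs ((numer F G n).[x] - x * (denom F G n).[x]))
        @[n --> \oo] --> local_height d F G phi x) &
      (forall (n : nat) (t : K), (0 < n)%N ->
        root (numer F G n - 'X * denom F G n) t <->
        iter n phi (Some t) = Some t)].
Proof.
have lhE : local_height d F G phi x = log_plus (pabs x).
  apply: (local_heightE p_prime good) => //.
  (* An affine periodic point is not a pole, so the denominator is not zero. *)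
  apply: contra_eq_neq (iter_phi_affine good 1 (y 1%N)) => D0.
  have [[n n0 yn] _] := y_period 1%N isT.
  rewrite D0 horner0 /P1_of eqxx /=; apply/eqP => y1.
  suff : iter n phi (Some (y 1%N)) = None by rewrite yn.
  by case: n n0 {yn} => // n _; rewrite iterSr y1; elim: n => //= n ->.
split=> //.
- exact: (chordal_cvg p_prime good).
- by rewrite lhE; exact: (ln_dist_period_cvg p_prime good).
- by rewrite lhE => aper; exact: (period_polynomial_cvg p_prime good).
- by move=> n t _; exact: (root_fixed good).
Qed.
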